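(* Let $k$ be an algebraically closed field of characteristic zero. Let $Y$ be a variety over $k$ and let $X$ be a quasi-projective variety over $k$. Let $(\phi_i \colon Y \to X)_{i \in I}$ be a family of morphisms. Suppose that there is a point $y_0 \in Y$ such that $\{ \phi_i(y_0) \mid i \in I\}$ is dense in $X$. Then the union of graphs $\bigcup_{i\in I} \Gamma_{\phi_i}$ is dense in $Y \times X$.
   Context: A variety over $k$ is an integral separated scheme of finite type over $k$. $\Gamma_{\phi}\subset Y\times X$ denotes the graph of a morphism $\phi\colon Y\to X$. Points are closed points, and density is in the Zariski topology. *)

(* Defs.v *)
(* Schemes over a field k.  A scheme is a locally ringed space that is locally
   isomorphic to the prime spectrum of a commutative ring, and a k-scheme
   carries a structure sheaf of k-algebras, which is the same thing as a
   morphism to Spec k. *)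
From HB Require Import structures.
From mathcomp Require Import all_boot all_order all_algebra.
From mathcomp Require Import boolp classical_sets topology.
From mathcomp Require Import (canonicals, coercions) mpoly.

Set Implicit Arguments.
Unset Strict Implicit.
Unset Printing Implicit Defensive.

Import GRing.Theory.
Local Open Scope ring_scope.
Local Open Scope classical_set_scope.

(* Sections are attached to every subset U, to avoid bundling openness proofs
   in the indices, but only the values on open sets matter.
   Rings may be trivial (comPzRingType) since O(set0) = 0. *)
Record ringed_space (k : fieldType) := RingedSpace {
  pt :> topologicalType;
  sect : set pt -> comPzRingType;
  res : forall U V : set pt, V `<=` U -> {rmorphism sect U -> sect V};
  cst : forall U : set pt, {rmorphism k -> sect U};
  res_id : forall (U : set pt) (UU : U `<=` U) (s : sect U),
    open U -> res UU s = s;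
  res_res : forall (U V W : set pt) (VU : V `<=` U) (WV : W `<=` V)
      (WU : W `<=` U) (s : sect U),
    open U -> open V -> open W -> res WV (res VU s) = res WU s;
  res_cst : forall (U V : set pt) (VU : V `<=` U) (a : k),
    open U -> open V -> res VU (cst U a) = cst V a;
  sheaf_sep : forall (I : Type) (V : I -> set pt) (U : set pt)
      (VU : forall i, V i `<=` U) (s t : sect U),
    open U -> (forall i, open (V i)) -> U `<=` \bigcup_i V i ->
    (forall i, res (VU i) s = res (VU i) t) -> s = t;
  sheaf_glue : forall (I : Type) (V : I -> set pt) (U : set pt)
      (VU : forall i, V i `<=` U) (s : forall i, sect (V i)),
    open U -> (forall i, open (V i)) -> U `<=` \bigcup_i V i ->
    (forall i j (Wi : V i `&` V j `<=` V i) (Wj : V i `&` V j `<=` V j),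
       res Wi (s i) = res Wj (s j)) ->
    exists t : sect U, forall i, res (VU i) t = s i
}.

Arguments sect {k} X U : rename.
Arguments res {k X U V} VU : rename.
Arguments cst {k} X U : rename.

(* The germ of s at x is a unit of the stalk at x. *)
Definition germ_unit (k : fieldType) (X : ringed_space k) (U : set X)
    (s : sect X U) (x : X) : Prop :=
  exists (V : set X) (VU : V `<=` U),
    [/\ open V, V x & exists t : sect X V, res VU s * t = 1].

(* Every stalk is nontrivial, and its non-units are closed under addition. *)
Definition locally_ringed (k : fieldType) (X : ringed_space k) : Prop :=
  forall (x : X) (U : set X), open U -> U x ->
    (1 : sect X U) <> 0 /\
    forall s t : sect X U, germ_unit (s + t) x -> germ_unit s x \/ germ_unit t x.

Definition basic_open (k : fieldType) (X : ringed_space k) (U : set X)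
    (f : sect X U) : set X :=
  [set x | germ_unit f x].

Lemma basic_open_sub (k : fieldType) (X : ringed_space k) (U : set X)
  (f : sect X U) : basic_open f `<=` U.
Proof. by move=> x [V [VU [_ Vx _]]]; apply: VU. Qed.

Definition prime_ideal (A : comPzRingType) (p : set A) : Prop :=
  [/\ p 0, forall a b, p a -> p b -> p (a + b),
      forall a b, p b -> p (a * b), ~ p 1 &
      forall a b, p (a * b) -> p a \/ p b].

(* (U, O_U) is isomorphic to Spec A for A = O(U).  The map U -> Spec A sends x
   to the prime ideal of the sections whose germ at x is not a unit; it must be
   a bijection, the sets D(f) must form a basis of the topology of U, and
   O(D(f)) must be the localization A_f. *)
Definition affine_open (k : fieldType) (X : ringed_space k) (U : set X) : Prop :=
  [/\ open U,
      forall p : set (sect X U), prime_ideal p ->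
        exists2 x, U x & p = [set s | ~ germ_unit s x],
      forall x y, U x -> U y ->
        (forall s : sect X U, germ_unit s x <-> germ_unit s y) -> x = y,
      forall (W : set X) x, open W -> W `<=` U -> W x ->
        exists f : sect X U, basic_open f x /\ basic_open f `<=` W &
      forall f : sect X U,
        (forall s : sect X U, res (@basic_open_sub _ _ _ f) s = 0 ->
           exists n : nat, f ^+ n * s = 0) /\
        (forall t : sect X (basic_open f), exists (n : nat) (s : sect X U),
           res (@basic_open_sub _ _ _ f) s
           = res (@basic_open_sub _ _ _ f) (f ^+ n) * t)].

Record scheme (k : fieldType) := Scheme {
  ringed_space_of :> ringed_space k;
  scheme_local : locally_ringed ringed_space_of;
  scheme_affine : forall x : ringed_space_of,
    exists2 U : set ringed_space_of, affine_open U & U x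
}.

Record morphism (k : fieldType) (X Y : scheme k) := Morphism {
  mfun :> X -> Y;
  mfun_cont : continuous mfun;
  pull : forall V : set Y, open V -> {rmorphism sect Y V -> sect X (mfun @^-1` V)};
  pull_res : forall (V W : set Y) (oV : open V) (oW : open W) (WV : W `<=` V)
      (fWV : mfun @^-1` W `<=` mfun @^-1` V) (s : sect Y V),
    res fWV (pull oV s) = pull oW (res WV s);
  pull_cst : forall (V : set Y) (oV : open V) (a : k),
    pull oV (cst Y V a) = cst X _ a;
  pull_local : forall (V : set Y) (oV : open V) (s : sect Y V) (x : X),
    V (mfun x) -> germ_unit (pull oV s) x -> germ_unit s (mfun x)
}.

Arguments pull {k X Y} f {V} oV : rename.

(* Equality of morphisms: same map on points, same comorphism.  The sets
   f @^-1` V and g @^-1` V are equal but not convertible, hence the restriction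
   to an open W contained in both. *)
Definition eq_mor (k : fieldType) (X Y : scheme k) (f g : morphism X Y) : Prop :=
  f =1 g /\
  forall (V : set Y) (W : set X) (oV : open V) (oW : open W)
      (Wf : W `<=` f @^-1` V) (Wg : W `<=` g @^-1` V) (s : sect Y V),
    res Wf (pull f oV s) = res Wg (pull g oV s).

Section IdComp.
Variable k : fieldType.

Lemma id_cont (X : scheme k) : continuous (fun x : X => x).
Proof. by move=> x. Qed.

Lemma id_pull_res (X : scheme k) (V W : set X) (oV : open V) (oW : open W)
  (WV WV' : W `<=` V) (s : sect X V) : res WV' s = res WV s.
Proof. by rewrite (Prop_irrelevance WV WV'). Qed.

Definition id_mor (X : scheme k) : morphism X X :=
  @Morphism k X X (fun x => x) (@id_cont X)
    (fun V _ => GRing.RMorphism.clone _ _ (@idfun (sect X V)) _)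
    (@id_pull_res X) (fun _ _ _ => erefl) (fun _ _ _ _ _ h => h).

Lemma open_preim (X Y : scheme k) (f : morphism X Y) (V : set Y) :
  open V -> open (f @^-1` V).
Proof. by move=> oV; have /continuousP := @mfun_cont _ _ _ f; apply. Qed.

Variables (X Y Z : scheme k) (g : morphism Y Z) (f : morphism X Y).

Lemma comp_cont : continuous (fun x => g (f x)).
Proof. by move=> x; apply: continuous_comp; apply: mfun_cont. Qed.

Definition comp_pull (V : set Z) (oV : open V) :
    {rmorphism sect Z V -> sect X ((fun x => g (f x)) @^-1` V)} :=
  GRing.RMorphism.clone _ _ (pull f (open_preim g oV) \o pull g oV) _.

Lemma comp_pull_res (V W : set Z) (oV : open V) (oW : open W) (WV : W `<=` V)
    (h : (fun x => g (f x)) @^-1` W `<=` (fun x => g (f x)) @^-1` V)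
    (s : sect Z V) :
  res h (comp_pull oV s) = comp_pull oW (res WV s).
Proof.
have gWV : g @^-1` W `<=` g @^-1` V by move=> y /WV.
rewrite /comp_pull /= -(@pull_res _ _ _ g V W oV oW WV gWV).
exact: (@pull_res _ _ _ f _ _ (open_preim g oV) (open_preim g oW) gWV h).
Qed.

Lemma comp_pull_cst (V : set Z) (oV : open V) (a : k) :
  comp_pull oV (cst Z V a) = cst X _ a.
Proof. by rewrite /comp_pull /= !pull_cst. Qed.

Lemma comp_pull_local (V : set Z) (oV : open V) (s : sect Z V) (x : X) :
  V (g (f x)) -> germ_unit (comp_pull oV s) x -> germ_unit s (g (f x)).
Proof.
move=> Vx u; apply: (@pull_local _ _ _ g V oV s (f x) Vx).
exact: (@pull_local _ _ _ f _ (open_preim g oV) (pull g oV s) x Vx u).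
Qed.

Definition comp_mor : morphism X Z :=
  Morphism comp_cont comp_pull_res comp_pull_cst comp_pull_local.

End IdComp.

(* P, with projections p and q, is the fibre product X x_k Y. *)
Definition is_product (k : fieldType) (X Y P : scheme k)
    (p : morphism P X) (q : morphism P Y) : Prop :=
  forall (T : scheme k) (f : morphism T X) (g : morphism T Y),
    exists h : morphism T P,
      [/\ eq_mor (comp_mor p h) f, eq_mor (comp_mor q h) g &
          forall h' : morphism T P,
            eq_mor (comp_mor p h') f -> eq_mor (comp_mor q h') g -> eq_mor h' h].

(* A homeomorphism onto its image that is surjective on stalks. *)
Definition embedding (k : fieldType) (X Y : scheme k) (f : morphism X Y) : Prop :=
  [/\ injective f,
      forall U : set X, open U -> exists2 V : set Y, open V & U = f @^-1` V &
      forall (x : X) (U : set X) (s : sect X U), open U -> U x ->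
        exists (V : set Y) (oV : open V) (t : sect Y V) (W : set X)
            (WU : W `<=` U) (WV : W `<=` f @^-1` V),
          [/\ open W, W x & res WU s = res WV (pull f oV t)]].

Definition closed_immersion (k : fieldType) (X Y : scheme k) (f : morphism X Y) :
  Prop := embedding f /\ closed (range f).

Definition immersion (k : fieldType) (X Y : scheme k) (f : morphism X Y) : Prop :=
  embedding f /\
  exists U C : set Y, [/\ open U, closed C & range f = U `&` C].

Definition integral (k : fieldType) (X : scheme k) : Prop :=
  [set: X] !=set0 /\
  forall U : set X, open U -> U !=set0 ->
    (1 : sect X U) <> 0 /\
    forall s t : sect X U, s * t = 0 -> s = 0 \/ t = 0.

Definition separated (k : fieldType) (X : scheme k) : Prop :=
  exists (P : scheme k) (p q : morphism P X) (d : morphism X P),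
    [/\ is_product p q, eq_mor (comp_mor p d) (id_mor X),
        eq_mor (comp_mor q d) (id_mor X) & closed_immersion d].

Definition fg_algebra (k : fieldType) (A : comPzRingType)
    (c : {rmorphism k -> A}) : Prop :=
  exists (n : nat) (g : 'I_n -> A), forall S : set A,
    (forall a, S (c a)) -> (forall i, S (g i)) ->
    (forall a b, S a -> S b -> S (a + b)) ->
    (forall a b, S a -> S b -> S (a * b)) -> forall a, S a.

Definition finite_type (k : fieldType) (X : scheme k) : Prop :=
  exists (n : nat) (U : 'I_n -> set X),
    [/\ forall i, affine_open (U i), forall i, fg_algebra (cst X (U i)) &
        forall x, exists i, U i x].

Definition variety (k : fieldType) (X : scheme k) : Prop :=
  [/\ integral X, separated X & finite_type X].

(* P is the projective n-space over k, glued from its standard charts U_i.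
   The chart U_i is the spectrum of
     k[X_0/X_i, ..., X_n/X_i] = k[X_0, ..., X_n] / (X_i - 1),
   where e i is the quotient map (X_j |-> X_j/X_i); U_i and U_j meet in the
   locus where X_j/X_i is invertible, and are glued by
   X_l/X_i = (X_j/X_i) (X_l/X_j). *)
Definition projective_space (k : fieldType) (n : nat) (P : scheme k) : Prop :=
  let pol := mpoly.mpoly n.+1 k in
  let X (i : 'I_n.+1) : pol := mpoly.mpolyX k (mpoly.mnm1 i) in
  exists (U : 'I_n.+1 -> set P)
      (e : forall i, {rmorphism pol -> sect P (U i)}),
    [/\ forall x, exists i, U i x,
        forall i, affine_open (U i),
        forall i, (forall a : k, e i (mpoly.mpolyC n.+1 a) = cst P (U i) a) /\
          (forall s, exists f, e i f = s) /\
          (forall f, e i f = 0 <-> exists g : pol, f = g * (X i - 1)),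
        forall i j, basic_open (e i (X j)) = U i `&` U j &
        forall i j l (Wi : U i `&` U j `<=` U i) (Wj : U i `&` U j `<=` U j),
          res Wi (e i (X l)) = res Wi (e i (X j)) * res Wj (e j (X l))].

Definition quasi_projective (k : fieldType) (X : scheme k) : Prop :=
  exists (n : nat) (P : scheme k) (f : morphism X P),
    projective_space n P /\ immersion f.

(* The graph of f : Y -> X inside the product P of Y and X: the image of the
   morphism (id, f) : Y -> P. *)
Definition graph (k : fieldType) (Y X P : scheme k) (p : morphism P Y)
    (q : morphism P X) (f : morphism Y X) : set P :=
  [set z | exists g : morphism Y P,
     [/\ eq_mor (comp_mor p g) (id_mor Y), eq_mor (comp_mor q g) f & range g z]].

(* Main.v *)
(* Proof.  Suppose an open O of P = Y x X contains z and misses all graphs.  Let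
   U, V be affine neighbourhoods of the projections of z.  Comparing P with the
   spectrum of the ring generated by O(U) and O(V) on U x V, one finds a section
   r = sum_j a_j b_j with a_j in O(U), b_j in O(V), which is a unit at z and not
   a unit outside O; take the number n of terms minimal, so that the b_j are
   linearly independent.  For every i, sum_j a_j phi_i^*(b_j) is nowhere a unit,
   hence zero, since Y is integral.  By the Nullstellensatz the functions have
   values in k at the closed point y0, and since the phi_i(y0) are dense in X,
   independence of the b_j gives indices i_1, ..., i_n for which the matrix
   b_j(phi_{i_l}(y0)) is invertible.  Then det(phi_{i_l}^*(b_j)) is a nonzero
   section on an open subset of Y, so Cramer's rule yields a_j = 0 for all j, and
   r = 0 is not a unit at z. *)

Require Import Defs.
From HB Require Import structures.
From mathcomp Require Import all_boot all_order all_algebra.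
From mathcomp Require Import boolp classical_sets topology.
From mathcomp Require Import ring.

Set Implicit Arguments.
Unset Strict Implicit.
Unset Printing Implicit Defensive.

Import GRing.Theory.
Local Open Scope ring_scope.
Local Open Scope classical_set_scope.

(** * Prime ideals *)

(** The product is given only by its universal property, which says nothing directly about its open
    sets. It has to be probed by test schemes, and this is why spectra are built here with their
    structure sheaves and their morphisms into affine charts. The ring on U x V is taken as a
    subring of the sections of [P], not as a tensor product: it is enough that its spectrum maps
    continuously to [P] and that every point over U x V lifts along this map, for then basic opens
    of the spectrum control the topology of [P]. On the algebraic side, the pullbacks of the b_j
    live on open sets that vary with the index of the morphism, so they cannot be compared on one
    domain. Values at the single point y0 turn their independence into a statement about row vectors
    over k, and only finitely many indices are then needed, whose domains meet in a neighbourhood of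
    y0. That neighbourhood is unrelated to U, which is chosen around the projection of z;
    irreducibility of Y connects the two. *)

Section PrimeIdeals.
Variable A : comPzRingType.

Definition is_ideal (I : set A) : Prop :=
  [/\ I 0, forall a b, I a -> I b -> I (a + b) & forall a b, I b -> I (a * b)].

Lemma prime_idealP (p : set A) : prime_ideal p -> is_ideal p.
Proof. by case. Qed.

Lemma prime_idealN1 (p : set A) : prime_ideal p -> ~ p 1.
Proof. by case. Qed.

Lemma prime_idealM (p : set A) a b : prime_ideal p -> ~ p a -> ~ p b -> ~ p (a * b).
Proof. by case=> _ _ _ _ pM na nb /pM[]. Qed.

Lemma prime_idealX (p : set A) a n : prime_ideal p -> ~ p a -> ~ p (a ^+ n).
Proof.
move=> pp na; elim: n => [|n IH]; first by rewrite expr0; apply: prime_idealN1.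
by rewrite exprS; apply: prime_idealM.
Qed.

Lemma prime_idealMl (p : set A) a b : prime_ideal p -> ~ p (a * b) -> ~ p b.
Proof. by case=> _ _ pM _ _ nab pb; apply: nab; apply: pM. Qed.

Lemma prime_idealMr (p : set A) a b : prime_ideal p -> ~ p (a * b) -> ~ p a.
Proof. by rewrite mulrC; apply: prime_idealMl. Qed.

Lemma prime_ideal_mull (p : set A) a b : prime_ideal p -> p b -> p (a * b).
Proof. by case=> _ _ pM _ _; apply: pM. Qed.

Lemma prime_ideal_mulr (p : set A) a b : prime_ideal p -> p a -> p (a * b).
Proof. by rewrite mulrC; apply: prime_ideal_mull. Qed.

Lemma is_ideal_addl (I : set A) a : is_ideal I ->
  is_ideal [set x | exists2 u, I u & exists v, x = u + v * a].
Proof.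
move=> [I0 ID IM]; split.
- by exists 0 => //; exists 0; ring.
- move=> _ _ [u Iu [v ->]] [u' Iu' [v' ->]].
  by exists (u + u'); [apply: ID|exists (v + v'); ring].
- move=> c _ [u Iu [v ->]].
  by exists (c * u); [apply: IM|exists (c * v); ring].
Qed.

(** Zorn's lemma, with [J] ranging over the sets for which the union of [I] and [J] is an ideal
    missing all powers of [f]. Keeping [I] outside the variable set makes the union of the empty
    chain admissible too. *)
Lemma prime_avoid (I : set A) f : is_ideal I -> (forall n, ~ I (f ^+ n)) ->
  exists2 p, prime_ideal p & I `<=` p /\ ~ p f.
Proof.
move=> [I0 ID IM] If.
pose P (J : set A) := is_ideal (I `|` J) /\ forall n, ~ (I `|` J) (f ^+ n).
have [|J [[[p0 pD pM] pf] Jmax]] := @Zorn_bigcup A P.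
  move=> F FP Ftot; split; last first.
    by move=> n [/If//|[X FX Xf]]; have [_ /(_ n)] := FP _ FX; apply; right.
  have incl X : F X -> I `|` X `<=` I `|` \bigcup_(X in F) X.
    by move=> FX a [|Xa]; [left|right; exists X].
  split; first by left.
  - move=> a b [Ia|[X FX Xa]] [Ib|[Z FZ Zb]].
    + by left; apply: ID.
    + by apply: (incl _ FZ); have [[_ D _] _] := FP _ FZ; apply: D; [left|right].
    + by apply: (incl _ FX); have [[_ D _] _] := FP _ FX; apply: D; [right|left].
    + have [XZ|ZX] := Ftot _ _ FX FZ.
      * apply: (incl _ FZ); have [[_ D _] _] := FP _ FZ.
        by apply: D; right => //; apply: XZ.
      * apply: (incl _ FX); have [[_ D _] _] := FP _ FX.
        by apply: D; right => //; apply: ZX.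
  - move=> a b [Ib|[X FX Xb]]; first by left; apply: IM.
    by apply: (incl _ FX); have [[_ _ M] _] := FP _ FX; apply: M; right.
pose p := I `|` J; rewrite -/p in p0 pD pM pf.
(* By maximality, adjoining any further element brings a power of [f] into the ideal. For [a], [b]
   outside [p] with [a * b] in [p], the product of the two powers would then lie in [p]. *)
have adj a : ~ p a -> exists n u v, p u /\ f ^+ n = u + v * a.
  move=> npa; pose K := [set x | exists2 u, p u & exists v, x = u + v * a].
  have pK : p `<=` K by move=> x px; exists x => //; exists 0; ring.
  have IK : I `|` K = K by apply: setUidr => x Ix; apply: pK; left.
  apply: contrapT => nex; apply: (Jmax K).
    split; first by move=> x Jx; apply: pK; right.
    by move=> /(_ a) KJ; apply: npa; right; apply: KJ; exists 0 => //; exists 1; ring.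
  rewrite /P IK; split; first exact: is_ideal_addl.
  by move=> n [u pu [v fE]]; apply: nex; exists n, u, v.
exists p; last by split; [move=> x; left|move/(_ 1%N): pf; rewrite expr1].
split=> //; first by move/(_ 0): pf; rewrite expr0.
move=> a b pab; apply: contrapT => /not_orP[/adj[n [u [v [pu fn]]]]].
move=> /adj[m [u' [v' [pu' fm]]]]; apply: (pf (n + m)%N).
rewrite exprD fn fm.
rewrite (_ : _ * _ = (u' + v' * b) * u + (v * a) * u' + (v * v') * (a * b)).
  by apply: (pD); [apply: pD|]; apply: pM.
by ring.
Qed.

(** Quasi-compactness of the basic open of [f]: if no power of [f] were a finite combination of
    elements of [H], some prime containing all of [H] would avoid [f]. *)
Lemma prime_cover (H : set A) f :
    (forall p, prime_ideal p -> ~ p f -> exists2 h, H h & ~ p h) ->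
  exists n m (c h : 'I_m -> A),
    (forall i, H (h i)) /\ f ^+ n = \sum_i c i * h i.
Proof.
move=> cov; pose I := [set x | exists m (c h : 'I_m -> A),
  (forall i, H (h i)) /\ x = \sum_i c i * h i].
apply: contrapT => nex.
have [||p pp [Ip pf]] := @prime_avoid I f.
- split.
  + by exists 0, (fun=> 0), (fun=> 0); split; [case|rewrite big_ord0].
  + move=> _ _ [m [c [h [Hh ->]]]] [m' [c' [h' [Hh' ->]]]].
    exists (m + m')%N, (fun i => match split i with inl j => c j | inr j => c' j end),
      (fun i => match split i with inl j => h j | inr j => h' j end).
    split; first by move=> i; case: split.
    rewrite big_split_ord /=; congr (_ + _); apply: eq_bigr => i _.
      by rewrite (unsplitK (inl i)).
    by rewrite (unsplitK (inr i)).
  + move=> a _ [m [c [h [Hh ->]]]]; exists m, (fun i => a * c i), h; split=> //.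
    by rewrite big_distrr; apply: eq_bigr => i _; rewrite /= mulrA.
- by move=> n [m [c [h Hh]]]; apply: nex; exists n, m, c, h.
have [h Hh ph] := cov p pp pf; apply: ph; apply: Ip.
by exists 1%N, (fun=> 1), (fun=> h); split=> //; rewrite big_ord1 mul1r.
Qed.

Lemma prime_nilpotent (I : set A) f : is_ideal I ->
  (forall p, prime_ideal p -> I `<=` p -> p f) -> exists n, I (f ^+ n).
Proof.
move=> iI sub; apply: contrapT => nex.
have [|p pp [Ip pf]] := @prime_avoid I f iI.
  by move=> n In; apply: nex; exists n.
by apply: pf; apply: sub.
Qed.

End PrimeIdeals.

(** * The spectrum of a ring *)

Record spec (A : comPzRingType) := Spec {
  ideal_at :> A -> Prop;
  ideal_at_prime : prime_ideal ideal_at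
}.

Section SpecSheaf.
Variable A : comPzRingType.

HB.instance Definition _ := gen_eqMixin (spec A).
HB.instance Definition _ := gen_choiceMixin (spec A).

Lemma spec_eq (p q : spec A) : (forall a, p a <-> q a) -> p = q.
Proof.
case: p q => p pp [q pq] /= pqE.
have {}pqE : p = q by apply/seteqP; split=> a /pqE.
by case: q / pqE pq => pq; congr Spec; apply: Prop_irrelevance.
Qed.

Definition spec_open (U : set (spec A)) : Prop :=
  forall p : spec A, U p -> exists2 g, ~ p g & forall q : spec A, ~ q g -> U q.

Lemma spec_openT : spec_open setT.
Proof. by move=> p _; exists 1 => //; apply: prime_idealN1 (ideal_at_prime p). Qed.

Lemma spec_openI : setI_closed spec_open.
Proof.
move=> U V oU oV p [/oU[g pg gU] /oV[h ph hV]]; exists (g * h).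
  exact: prime_idealM (ideal_at_prime p) pg ph.
move=> q qgh; split; [apply: gU|apply: hV].
  exact: prime_idealMr (ideal_at_prime q) qgh.
exact: prime_idealMl (ideal_at_prime q) qgh.
Qed.

Lemma spec_open_bigU (I : Type) (f : I -> set (spec A)) :
  (forall i, spec_open (f i)) -> spec_open (\bigcup_i f i).
Proof.
move=> fo p [i _ /fo[g pg gU]]; exists g => // q /gU fq; by exists i.
Qed.

HB.instance Definition _ :=
  isOpenTopological.Build (spec A) spec_openT spec_openI spec_open_bigU.

(** Equality of [a / b] and [c / d] in the localization at [p]; the factor [t] is there because of
    zero divisors. *)
Definition same_frac (p : set A) (a b c d : A) : Prop :=
  exists2 t, ~ p t & t * (a * d) = t * (c * b).

Lemma same_frac_eq (p : spec A) a b c d : a * d = c * b -> same_frac p a b c d.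
Proof. by move=> e; exists 1; [apply: prime_idealN1 (ideal_at_prime p)|rewrite e]. Qed.

Lemma same_frac_sym (p : set A) a b c d : same_frac p a b c d -> same_frac p c d a b.
Proof. by case=> t pt e; exists t. Qed.

Lemma same_frac_trans (p : spec A) a b c d e f : ~ p d ->
  same_frac p a b c d -> same_frac p c d e f -> same_frac p a b e f.
Proof.
move=> pd [t pt tE] [u pu uE]; exists (t * u * d).
  have pp := ideal_at_prime p.
  by apply: prime_idealM => //; apply: prime_idealM.
transitivity (u * f * (t * (a * d))); first by ring.
rewrite tE; transitivity (t * b * (u * (c * f))); first by ring.
by rewrite uE; ring.
Qed.

(* A section is encoded by the relation [s q a b] saying that its germ at [q]
   is the fraction [a / b] of the local ring at [q]. *)
Definition is_section (U : set (spec A)) (s : spec A -> A -> A -> Prop) : Prop :=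
  [/\ forall q a b, s q a b -> U q /\ ~ q b,
      forall q a b c d, s q a b -> (s q c d <-> ~ q d /\ same_frac q a b c d) &
      forall q : spec A, U q -> exists g a b, ~ q g /\
        forall q' : spec A, U q' -> ~ q' g -> s q' a b].

Record spec_sect (U : set (spec A)) := SpecSect {
  germ :> spec A -> A -> A -> Prop;
  germP : is_section U germ
}.

HB.instance Definition _ U := gen_eqMixin (spec_sect U).
HB.instance Definition _ U := gen_choiceMixin (spec_sect U).

Section Germ.
Variables (U : set (spec A)) (s t : spec_sect U).

Lemma germ_dom (q : spec A) a b : s q a b -> U q.
Proof. by case: (germP s) => d _ _ /d[]. Qed.

Lemma germ_den (q : spec A) a b : s q a b -> ~ q b.
Proof. by case: (germP s) => d _ _ /d[]. Qed.

Lemma germ_same (q : spec A) a b c d : s q a b -> s q c d -> same_frac q a b c d.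
Proof. by case: (germP s) => _ e _ sab /(e _ _ _ _ _ sab)[]. Qed.

Lemma germ_trans (q : spec A) a b c d :
  s q a b -> ~ q d -> same_frac q a b c d -> s q c d.
Proof. by case: (germP s) => _ e _ sab qd abcd; apply/(e _ _ _ _ _ sab). Qed.

Lemma germ_local (q : spec A) : U q -> exists g a b, ~ q g /\
  forall q' : spec A, U q' -> ~ q' g -> s q' a b.
Proof. by case: (germP s) => _ _ l /l. Qed.

Lemma germ_ex (q : spec A) : U q -> exists a b, s q a b.
Proof. by move=> Uq; have [g [a [b [qg]]]] := germ_local Uq; exists a, b; auto. Qed.

Lemma spec_sect_ext :
  (forall q : spec A, U q -> exists a b c d,
     [/\ s q a b, t q c d & same_frac q a b c d]) -> s = t.
Proof.
move=> st; have e : germ s = germ t.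
  apply/funext => q; apply/funext => x; apply/funext => y; apply/propext.
  split=> h.
    have [a [b [c [d [sab tcd abcd]]]]] := st q (germ_dom h).
    have [_ /(_ _ _ _ _ _ tcd) -> _] := germP t; split; first exact: germ_den h.
    apply: same_frac_trans (germ_den sab) (same_frac_sym abcd) _.
    exact: germ_same sab h.
  have [|a [b [c [d [sab tcd abcd]]]]] := st q.
    by have [D _ _] := germP t; have [] := D _ _ _ h.
  have [D E _] := germP t; have [_ /(_ _ _ _ _ _ sab) -> _] := germP s.
  have [_ qy] := D _ _ _ h; split=> //; have [_ qd] := D _ _ _ tcd.
  by apply: same_frac_trans qd abcd _; have [/(_ h)[]] := E _ _ _ x y tcd.
case: s t e => s' sP [t' tP] /= e; case: t' / e tP => tP.
by congr SpecSect; apply: Prop_irrelevance.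
Qed.

End Germ.

Section MakeSection.
Variables (U : set (spec A)) (r : spec A -> A -> A -> Prop).
Hypothesis r_dom : forall (q : spec A) a b, r q a b -> U q /\ ~ q b.
Hypothesis r_same : forall (q : spec A) a b c d,
  r q a b -> r q c d -> same_frac q a b c d.
Hypothesis r_local : forall q : spec A, U q -> exists g a b, ~ q g /\
  forall q' : spec A, U q' -> ~ q' g -> r q' a b.

(** A construction usually yields only some fractions for each germ, whereas [is_section] asks for
    all of them; this closes [r] under equality of fractions. *)
Definition close_germ (q : spec A) c d : Prop :=
  ~ q d /\ exists a b, r q a b /\ same_frac q a b c d.

Lemma close_germ_incl (q : spec A) a b : r q a b -> close_germ q a b.
Proof.
move=> rab; split; first by case: (r_dom rab).
by exists a, b; split=> //; apply: same_frac_eq.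
Qed.

Lemma close_germP : is_section U close_germ.
Proof.
split.
- by move=> q c d [qd [a [b [/r_dom[]]]]].
- move=> q a b c d [qb [x [y [rxy xyab]]]]; split=> [|[qd abcd]].
    move=> [qd [x' [y' [rxy' xycd]]]]; split=> //.
    have [_ qy] := r_dom rxy; have [_ qy'] := r_dom rxy'.
    apply: same_frac_trans qy (same_frac_sym xyab) _.
    by apply: same_frac_trans qy' _ xycd; apply: r_same.
  by split=> //; exists x, y; split=> //; apply: same_frac_trans qb xyab abcd.
- move=> q /r_local[g [a [b [qg gr]]]]; exists g, a, b; split=> // q' Uq' qg'.
  exact/close_germ_incl/gr.
Qed.

Definition make_sect : spec_sect U := SpecSect close_germP.

Lemma make_sectE (q : spec A) a b : r q a b -> make_sect q a b.
Proof. exact: close_germ_incl. Qed.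

End MakeSection.

Section ConstSect.
Variables (U : set (spec A)) (a : A).

Let r (q : spec A) (x y : A) := [/\ U q, x = a & y = 1].

Let r_dom (q : spec A) x y : r q x y -> U q /\ ~ q y.
Proof. by case=> Uq _ ->; split=> //; apply: prime_idealN1 (ideal_at_prime q). Qed.

Let r_same (q : spec A) x y z w : r q x y -> r q z w -> same_frac q x y z w.
Proof. by case=> _ -> -> [_ -> ->]; apply: same_frac_eq. Qed.

Let r_local (q : spec A) : U q -> exists g x y, ~ q g /\
  forall q' : spec A, U q' -> ~ q' g -> r q' x y.
Proof.
by move=> Uq; exists 1, a, 1; split=> //; apply: prime_idealN1 (ideal_at_prime q).
Qed.

Definition const_sect : spec_sect U := make_sect r_dom r_same r_local.

Lemma const_sectE (q : spec A) : U q -> const_sect q a 1.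
Proof. by move=> Uq; apply: make_sectE. Qed.

End ConstSect.

Section BinarySect.
Variables (U : set (spec A)) (n : A -> A -> A -> A -> A).
Hypothesis n_congr : forall a b a' b' c d c' d' t u : A,
  t * (a * b') = t * (a' * b) -> u * (c * d') = u * (c' * d) ->
  t * u * (n a b c d * (b' * d')) = t * u * (n a' b' c' d' * (b * d)).
Variables s t : spec_sect U.

Let r (q : spec A) (x y : A) :=
  exists a b c d, [/\ s q a b, t q c d, x = n a b c d & y = b * d].

Let r_dom (q : spec A) x y : r q x y -> U q /\ ~ q y.
Proof.
move=> [a [b [c [d [sab tcd _ ->]]]]]; split; first exact: germ_dom sab.
exact: prime_idealM (ideal_at_prime q) (germ_den sab) (germ_den tcd).
Qed.

Let r_same (q : spec A) x y z w : r q x y -> r q z w -> same_frac q x y z w.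
Proof.
move=> [a [b [c [d [sab tcd -> ->]]]]] [a' [b' [c' [d' [sab' tcd' -> ->]]]]].
have [v qv vE] := germ_same sab sab'; have [u qu uE] := germ_same tcd tcd'.
exists (v * u); first exact: prime_idealM (ideal_at_prime q) qv qu.
exact: n_congr.
Qed.

Let r_local (q : spec A) : U q -> exists g x y, ~ q g /\
  forall q' : spec A, U q' -> ~ q' g -> r q' x y.
Proof.
move=> Uq; have [g [a [b [qg gs]]]] := germ_local s Uq.
have [h [c [d [qh ht]]]] := germ_local t Uq.
exists (g * h), (n a b c d), (b * d).
split=> [|q' Uq' qgh]; first exact: prime_idealM (ideal_at_prime q) qg qh.
have pq := ideal_at_prime q'.
exists a, b, c, d; split=> //; [apply: gs => //|apply: ht => //].
  exact: prime_idealMr pq qgh.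
exact: prime_idealMl pq qgh.
Qed.

(** Sum and product both send [a / b] and [c / d] to a fraction with denominator [b * d]. They share
    this construction, and [n_congr] is the independence of the chosen fractions. *)
Definition binary_sect : spec_sect U := make_sect r_dom r_same r_local.

Lemma binary_sectE (q : spec A) a b c d :
  s q a b -> t q c d -> binary_sect q (n a b c d) (b * d).
Proof. by move=> sab tcd; apply: make_sectE; exists a, b, c, d. Qed.

End BinarySect.

Section Ring.
Variable U : set (spec A).
Implicit Types s t u : spec_sect U.

Lemma add_congr (a b a' b' c d c' d' t u : A) :
  t * (a * b') = t * (a' * b) -> u * (c * d') = u * (c' * d) ->
  t * u * ((a * d + c * b) * (b' * d')) = t * u * ((a' * d' + c' * b') * (b * d)).
Proof.
move=> tE uE.
transitivity (u * d * d' * (t * (a * b')) + t * b * b' * (u * (c * d'))); first by ring.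
by rewrite tE uE; ring.
Qed.

Lemma mul_congr (a b a' b' c d c' d' t u : A) :
  t * (a * b') = t * (a' * b) -> u * (c * d') = u * (c' * d) ->
  t * u * ((a * c) * (b' * d')) = t * u * ((a' * c') * (b * d)).
Proof.
move=> tE uE; transitivity ((t * (a * b')) * (u * (c * d'))); first by ring.
by rewrite tE uE; ring.
Qed.

Definition add_sect s t : spec_sect U := binary_sect add_congr s t.
Definition mul_sect s t : spec_sect U := binary_sect mul_congr s t.
Definition opp_sect s : spec_sect U := mul_sect (const_sect U (-1)) s.

Lemma add_sectE s t (q : spec A) a b c d :
  s q a b -> t q c d -> add_sect s t q (a * d + c * b) (b * d).
Proof. exact: (binary_sectE add_congr). Qed.

Lemma mul_sectE s t (q : spec A) a b c d :
  s q a b -> t q c d -> mul_sect s t q (a * c) (b * d).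
Proof. exact: (binary_sectE mul_congr). Qed.

Lemma opp_sectE s (q : spec A) a b : s q a b -> opp_sect s q (- a) b.
Proof.
move=> sab; rewrite (_ : - a = -1 * a); last by ring.
by rewrite -[b]mul1r; apply: mul_sectE => //; apply: const_sectE; apply: germ_dom sab.
Qed.

Lemma add_sectA : associative add_sect.
Proof.
move=> s t u; apply: spec_sect_ext => q Uq.
have [a [b sab]] := germ_ex s Uq; have [c [d tcd]] := germ_ex t Uq.
have [e [f uef]] := germ_ex u Uq.
exists (a * (d * f) + (c * f + e * d) * b), (b * (d * f)),
  ((a * d + c * b) * f + e * (b * d)), (b * d * f).
split; [|  |by apply: same_frac_eq; ring].
  by do ?apply: add_sectE.
by do ?apply: add_sectE.
Qed.

Lemma add_sectC : commutative add_sect.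
Proof.
move=> s t; apply: spec_sect_ext => q Uq.
have [a [b sab]] := germ_ex s Uq; have [c [d tcd]] := germ_ex t Uq.
exists (a * d + c * b), (b * d), (c * b + a * d), (d * b).
by split; [apply: add_sectE|apply: add_sectE|apply: same_frac_eq; ring].
Qed.

Lemma add0_sect : left_id (const_sect U 0) add_sect.
Proof.
move=> s; apply: spec_sect_ext => q Uq; have [a [b sab]] := germ_ex s Uq.
exists (0 * b + a * 1), (1 * b), a, b; split=> //; last by apply: same_frac_eq; ring.
by apply: add_sectE => //; apply: const_sectE.
Qed.

Lemma addN_sect : left_inverse (const_sect U 0) opp_sect add_sect.
Proof.
move=> s; apply: spec_sect_ext => q Uq; have [a [b sab]] := germ_ex s Uq.
exists (- a * b + a * b), (b * b), 0, 1; split; last by apply: same_frac_eq; ring.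
  by apply: add_sectE => //; apply: opp_sectE.
exact: const_sectE.
Qed.

Lemma mul_sectA : associative mul_sect.
Proof.
move=> s t u; apply: spec_sect_ext => q Uq.
have [a [b sab]] := germ_ex s Uq; have [c [d tcd]] := germ_ex t Uq.
have [e [f uef]] := germ_ex u Uq.
exists (a * (c * e)), (b * (d * f)), (a * c * e), (b * d * f).
split; [|  |by apply: same_frac_eq; ring].
  by do ?apply: mul_sectE.
by do ?apply: mul_sectE.
Qed.

Lemma mul_sectC : commutative mul_sect.
Proof.
move=> s t; apply: spec_sect_ext => q Uq.
have [a [b sab]] := germ_ex s Uq; have [c [d tcd]] := germ_ex t Uq.
exists (a * c), (b * d), (c * a), (d * b).
by split; [apply: mul_sectE|apply: mul_sectE|apply: same_frac_eq; ring].
Qed.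

Lemma mul1_sect : left_id (const_sect U 1) mul_sect.
Proof.
move=> s; apply: spec_sect_ext => q Uq; have [a [b sab]] := germ_ex s Uq.
exists (1 * a), (1 * b), a, b; split=> //; last by apply: same_frac_eq; ring.
by apply: mul_sectE => //; apply: const_sectE.
Qed.

Lemma mul_sectDl : left_distributive mul_sect add_sect.
Proof.
move=> s t u; apply: spec_sect_ext => q Uq.
have [a [b sab]] := germ_ex s Uq; have [c [d tcd]] := germ_ex t Uq.
have [e [f uef]] := germ_ex u Uq.
exists ((a * d + c * b) * e), (b * d * f),
  (a * e * (d * f) + c * e * (b * f)), (b * f * (d * f)).
split; last by apply: same_frac_eq; ring.
  by apply: mul_sectE => //; apply: add_sectE.
by apply: add_sectE => //; apply: mul_sectE.
Qed.

HB.instance Definition _ := GRing.isZmodule.Build (spec_sect U)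
  add_sectA add_sectC add0_sect addN_sect.
HB.instance Definition _ := GRing.Zmodule_isComPzRing.Build (spec_sect U)
  mul_sectA mul_sectC mul1_sect mul_sectDl.

Lemma germD s t (q : spec A) a b c d :
  s q a b -> t q c d -> germ (s + t) q (a * d + c * b) (b * d).
Proof. exact: add_sectE. Qed.

Lemma germM s t (q : spec A) a b c d :
  s q a b -> t q c d -> germ (s * t)%R q (a * c) (b * d).
Proof. exact: mul_sectE. Qed.

Lemma germN s (q : spec A) a b : s q a b -> germ (- s) q (- a) b.
Proof. exact: opp_sectE. Qed.

Lemma germ1 (q : spec A) : U q -> (1 : spec_sect U) q 1 1.
Proof. exact: const_sectE. Qed.

Lemma germ0 (q : spec A) : U q -> (0 : spec_sect U) q 0 1.
Proof. exact: const_sectE. Qed.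

End Ring.
End SpecSheaf.

(** * The spectrum as a locally ringed space *)

Section SpecSpace.
Variable A : comPzRingType.

Section Restriction.
Variables (U V : set (spec A)) (VU : V `<=` U).

Lemma restr_sectP (s : spec_sect U) : is_section V (fun q a b => V q /\ s q a b).
Proof.
split.
- by move=> q a b [Vq /germ_den].
- move=> q a b c d [Vq sab]; split.
    by move=> [_ scd]; split; [apply: germ_den scd|apply: germ_same sab scd].
  by move=> [qd abcd]; split=> //; apply: germ_trans sab qd abcd.
- move=> q Vq; have [g [a [b [qg gs]]]] := germ_local s (VU Vq).
  by exists g, a, b; split=> // q' Vq' qg'; split=> //; apply: gs => //; apply: VU.
Qed.

Definition restr_sect (s : spec_sect U) : spec_sect V := SpecSect (restr_sectP s).

Lemma restr_sectE (s : spec_sect U) (q : spec A) a b :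
  V q -> s q a b -> restr_sect s q a b.
Proof. by []. Qed.

Lemma restr_sectB : zmod_morphism restr_sect.
Proof.
move=> s t; apply: spec_sect_ext => q Vq.
have [a [b sab]] := germ_ex s (VU Vq); have [c [d tcd]] := germ_ex t (VU Vq).
exists (a * d + - c * b), (b * d), (a * d + - c * b), (b * d).
split; last exact: same_frac_eq.
  by apply: restr_sectE => //; apply: germD => //; apply: germN.
by apply: germD; [|apply: germN]; apply: restr_sectE.
Qed.

Lemma restr_sectM : monoid_morphism restr_sect.
Proof.
split=> [|s t]; apply: spec_sect_ext => q Vq.
  exists 1, 1, 1, 1; split; last exact: same_frac_eq.
    by apply: restr_sectE => //; apply: germ1; apply: VU.
  exact: germ1.
have [a [b sab]] := germ_ex s (VU Vq); have [c [d tcd]] := germ_ex t (VU Vq).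
exists (a * c), (b * d), (a * c), (b * d).
split; last exact: same_frac_eq.
  by apply: restr_sectE => //; apply: germM.
by apply: germM; apply: restr_sectE.
Qed.

HB.instance Definition _ :=
  GRing.isZmodMorphism.Build (spec_sect U) (spec_sect V) restr_sect restr_sectB.
HB.instance Definition _ :=
  GRing.isMonoidMorphism.Build (spec_sect U) (spec_sect V) restr_sect restr_sectM.

Definition restr_mor : {rmorphism spec_sect U -> spec_sect V} := restr_sect.

End Restriction.

Section Const.
Variable U : set (spec A).

Lemma const_sectB : zmod_morphism (const_sect U).
Proof.
move=> a b; apply: spec_sect_ext => q Uq.
exists (a - b), 1, (a * 1 + - b * 1), (1 * 1).
split; [exact: const_sectE| |by apply: same_frac_eq; ring].
by apply: germD; [|apply: germN]; apply: const_sectE.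
Qed.

Lemma const_sectM : monoid_morphism (const_sect U).
Proof.
split=> // a b; apply: spec_sect_ext => q Uq.
exists (a * b), 1, (a * b), (1 * 1).
split; [exact: const_sectE| |by apply: same_frac_eq; ring].
by apply: germM; apply: const_sectE.
Qed.

HB.instance Definition _ :=
  GRing.isZmodMorphism.Build A (spec_sect U) (const_sect U) const_sectB.
HB.instance Definition _ :=
  GRing.isMonoidMorphism.Build A (spec_sect U) (const_sect U) const_sectM.

Definition const_mor : {rmorphism A -> spec_sect U} := const_sect U.

Lemma const_sect_germ a (s : spec_sect U) :
  (forall q, U q -> s q a 1) -> s = const_sect U a.
Proof.
move=> sa; apply: spec_sect_ext => q Uq; exists a, 1, a, 1.
by split; [exact: sa|exact: const_sectE|exact: same_frac_eq].
Qed.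

End Const.

Variables (k : fieldType) (c : {rmorphism k -> A}).

Definition spec_cst (U : set (spec A)) : {rmorphism k -> spec_sect U} :=
  GRing.RMorphism.clone _ _ (const_mor U \o c) _.

Lemma spec_res_id (U : set (spec A)) (UU : U `<=` U) (s : spec_sect U) :
  open U -> restr_mor UU s = s.
Proof.
move=> _; apply: spec_sect_ext => q Uq; have [a [b sab]] := germ_ex s Uq.
by exists a, b, a, b; split=> //; apply: same_frac_eq.
Qed.

Lemma spec_res_res (U V W : set (spec A)) (VU : V `<=` U) (WV : W `<=` V)
    (WU : W `<=` U) (s : spec_sect U) : open U -> open V -> open W ->
  restr_mor WV (restr_mor VU s) = restr_mor WU s.
Proof.
move=> _ _ _; apply: spec_sect_ext => q Wq; have [a [b sab]] := germ_ex s (WU _ Wq).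
exists a, b, a, b; split=> //; last exact: same_frac_eq.
by apply: restr_sectE => //; apply: restr_sectE => //; apply: WV.
Qed.

Lemma restr_const (U V : set (spec A)) (VU : V `<=` U) a :
  restr_mor VU (const_sect U a) = const_sect V a.
Proof.
apply: const_sect_germ => q Vq; apply: restr_sectE => //.
by apply: const_sectE; apply: VU.
Qed.

Lemma spec_res_cst (U V : set (spec A)) (VU : V `<=` U) (a : k) :
  open U -> open V -> restr_mor VU (spec_cst U a) = spec_cst V a.
Proof. by move=> _ _; apply: restr_const. Qed.

Lemma spec_sheaf_sep (I : Type) (V : I -> set (spec A)) (U : set (spec A))
    (VU : forall i, V i `<=` U) (s t : spec_sect U) :
  open U -> (forall i, open (V i)) -> U `<=` \bigcup_i V i ->
  (forall i, restr_mor (VU i) s = restr_mor (VU i) t) -> s = t.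
Proof.
move=> _ _ cov st; apply: spec_sect_ext => q Uq; have [i _ Viq] := cov q Uq.
have [a [b sab]] := germ_ex s Uq.
exists a, b, a, b; split=> //; last exact: same_frac_eq.
have : restr_mor (VU i) s q a b by apply: restr_sectE.
by rewrite st => -[].
Qed.

Lemma spec_sheaf_glue (I : Type) (V : I -> set (spec A)) (U : set (spec A))
    (VU : forall i, V i `<=` U) (s : forall i, spec_sect (V i)) :
  open U -> (forall i, open (V i)) -> U `<=` \bigcup_i V i ->
  (forall i j (Wi : V i `&` V j `<=` V i) (Wj : V i `&` V j `<=` V j),
     restr_mor Wi (s i) = restr_mor Wj (s j)) ->
  exists t : spec_sect U, forall i, restr_mor (VU i) t = s i.
Proof.
(* The glued germ at [q] collects the fractions of all pieces defined at [q]; by [ij] these pieces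
   have the same fractions there. *)
move=> oU oV cov sij; pose r q a b := exists i, s i q a b.
have ij i j (q : spec A) a b : V j q -> s i q a b -> s j q a b.
  move=> Vj sab; have Vi := germ_dom sab.
  have : restr_mor (@subIsetl _ (V i) (V j)) (s i) q a b by split.
  by rewrite (sij i j _ (@subIsetr _ (V i) (V j))) => -[].
have rP : is_section U r.
  split.
  - move=> q a b [i sab]; split; [exact: VU (germ_dom sab)|exact: germ_den sab].
  - move=> q a b x y [i sab]; split.
      move=> [j sxy]; have {}sab := ij _ _ _ _ _ (germ_dom sxy) sab.
      by split; [apply: germ_den sxy|apply: germ_same sab sxy].
    by move=> [qy abxy]; exists i; apply: germ_trans sab qy abxy.
  - move=> q Uq; have [i _ Viq] := cov q Uq.
    have [g [a [b [qg gs]]]] := germ_local (s i) Viq.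
    have [h qh hV] := oV i q Viq; exists (g * h), a, b.
    split=> [|q' Uq' qgh]; first exact: prime_idealM (ideal_at_prime q) qg qh.
    exists i; apply: gs; last exact: prime_idealMr (ideal_at_prime q') qgh.
    exact/hV/(prime_idealMl (ideal_at_prime q') qgh).
exists (SpecSect rP) => i; apply: spec_sect_ext => q Viq.
have [a [b sab]] := germ_ex (s i) Viq.
exists a, b, a, b; split=> //; last exact: same_frac_eq.
by split=> //; exists i.
Qed.

Definition spec_space : ringed_space k := RingedSpace
  spec_res_id spec_res_res spec_res_cst spec_sheaf_sep spec_sheaf_glue.

Lemma germ_unit_specP (U : set (spec A)) (s : spec_sect U) (q : spec A) :
  open U ->
  germ_unit (s : sect spec_space U) q <-> exists a b, s q a b /\ ~ q a.
Proof.
move=> oU; split.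
  move=> [V [VU [oV Vq [t /= st1]]]].
  have [a [b sab]] := germ_ex s (VU _ Vq); have [x [y txy]] := germ_ex t Vq.
  exists a, b; split=> // qa.
  have : (1 : spec_sect V) q (a * x) (b * y).
    by rewrite -st1; apply: germM => //; apply: restr_sectE.
  move=> h; have [u qu] := germ_same h (germ1 Vq).
  rewrite mulr1 mul1r => e.
  have pq := ideal_at_prime q.
  apply: (prime_idealM pq qu (prime_idealM pq (germ_den sab) (germ_den txy))).
  by rewrite -e; apply: prime_ideal_mull => //; apply: prime_ideal_mulr.
move=> [a [b [sab qa]]]; have Uq := germ_dom sab.
have [g [x [y [qg gs]]]] := germ_local s Uq; have [h qh hU] := oU _ Uq.
have pq := ideal_at_prime q.
have qx : ~ q x.
  have [u qu uE] := germ_same sab (gs _ Uq qg) => qx.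
  have /(prime_idealM pq qu) : ~ q (a * y).
    by apply: prime_idealM pq qa _; apply: germ_den (gs _ Uq qg).
  by apply; rewrite uE; apply: prime_ideal_mull => //; apply: prime_ideal_mulr.
(* On this basic open, [h] keeps the points inside [U], [g] ensures that [s] is [x / y], and [x] is
   invertible, so that [y / x] is a section inverse to [s]. *)
pose V : set (spec A) := [set q' | ~ q' (g * h * x)].
have VU : V `<=` U.
  move=> q' Vq'; have pq' := ideal_at_prime q'.
  by apply: hU; apply: prime_idealMl pq' (prime_idealMr pq' Vq').
have Vg (q' : spec A) : V q' -> ~ q' g.
  by move=> Vq'; have pq' := ideal_at_prime q'; exact: prime_idealMr pq' (prime_idealMr pq' Vq').
have Vx (q' : spec A) : V q' -> ~ q' x.
  by move=> Vq'; have pq' := ideal_at_prime q'; exact: prime_idealMl pq' Vq'.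
exists V, VU; split.
- by move=> q' Vq'; exists (g * h * x).
- by apply: prime_idealM => //; apply: prime_idealM.
pose r (q' : spec A) a' b' := [/\ V q', a' = y & b' = x].
have r1 (q' : spec A) a' b' : r q' a' b' -> V q' /\ ~ q' b'.
  by move=> [Vq' _ ->]; split=> //; apply: Vx.
have r2 (q' : spec A) a' b' c' d' : r q' a' b' -> r q' c' d' -> same_frac q' a' b' c' d'.
  by move=> [_ -> ->] [_ -> ->]; apply: same_frac_eq.
have r3 (q' : spec A) : V q' -> exists g a b, ~ q' g /\
    forall q'' : spec A, V q'' -> ~ q'' g -> r q'' a b.
  by move=> Vq'; exists 1, y, x; split=> //; apply: prime_idealN1 (ideal_at_prime q').
exists (make_sect r1 r2 r3); apply: spec_sect_ext => q' Vq'.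
exists (x * y), (y * x), 1, 1; split; last by apply: same_frac_eq; ring.
  apply: germM; last by apply: make_sectE.
  by apply: restr_sectE => //; apply: gs; [apply: VU|apply: Vg].
exact: germ1.
Qed.

Lemma germ_unit_const (U : set (spec A)) a (q : spec A) : open U -> U q ->
  germ_unit (const_sect U a : sect spec_space U) q <-> ~ q a.
Proof.
move=> oU Uq; split=> [/(germ_unit_specP _ _ oU)[x [y [axy qx]]] qa|qa].
  have [t qt] := germ_same axy (const_sectE a Uq); rewrite mulr1 => e.
  have pq := ideal_at_prime q; apply: (prime_idealM pq qt qx).
  by rewrite e; apply: prime_ideal_mull => //; apply: prime_ideal_mulr.
by apply/germ_unit_specP => //; exists a, 1; split=> //; apply: const_sectE.
Qed.

Lemma spec_space_local : locally_ringed spec_space.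
Proof.
move=> q U oU Uq; split.
  move=> /(congr1 (fun s : spec_sect U => s q 1 1)) e.
  have h : (0 : spec_sect U) q 1 1 by rewrite -e; apply: germ1.
  have [t qt] := germ_same (germ0 Uq) h; rewrite !mulr1 mulr0 => t0.
  by apply: qt; rewrite -t0; have [] := ideal_at_prime q.
move=> s t /(germ_unit_specP _ _ oU)[x [y [stxy qx]]].
have [a [b sab]] := germ_ex (s : spec_sect U) Uq.
have [a' [b' tab]] := germ_ex (t : spec_sect U) Uq.
have pq := ideal_at_prime q.
have nsum : ~ q (a * b' + a' * b).
  have [u qu uE] := germ_same (germD sab tab) stxy => qab.
  apply: (prime_idealM pq qu (prime_idealM pq qx (prime_idealM pq (germ_den sab) (germ_den tab)))).
  by rewrite -uE; apply: prime_ideal_mull => //; apply: prime_ideal_mulr.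
have [qa|qa] := pselect (q a); [right|left].
  apply/(germ_unit_specP _ _ oU); exists a', b'; split=> // qa'; apply: nsum.
  by have [_ qD _ _ _] := pq; apply: qD; apply: prime_ideal_mulr.
by apply/(germ_unit_specP _ _ oU); exists a, b.
Qed.

Section BasicOpen.
Variables (f : A) (U : set (spec A)).
Hypothesis UE : forall q : spec A, U q <-> ~ q f.

(** If [a] is zero in every stalk over the basic open of [f], no prime avoiding [f] contains the
    annihilator of [a]; hence a power of [f] annihilates [a]. *)
Lemma const_sect_eq0 a : const_sect U a = 0 -> exists n, f ^+ n * a = 0.
Proof.
move=> a0.
have [||n fn] := @prime_nilpotent A [set x | x * a = 0] f.
- split; first by rewrite /= mul0r.
  + by move=> x y /= xa ya; rewrite mulrDl xa ya addr0.
  + by move=> x y /= ya; rewrite -mulrA ya mulr0.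
- move=> p pp ap; apply: contrapT => pf; have Uq : U (Spec pp) by apply/UE.
  have : const_sect U a (Spec pp) a 1 by apply: const_sectE.
  rewrite a0 => h; have [t /= pt e] := germ_same (germ0 Uq) h.
  by apply: pt; apply: ap => /=; move: e; rewrite mul0r mulr0 mulr1.
- by exists n.
Qed.

End BasicOpen.

Lemma const_sect_eq (f : A) (U : set (spec A)) a b :
  (forall q : spec A, U q <-> ~ q f) -> const_sect U a = const_sect U b ->
  exists n, f ^+ n * a = f ^+ n * b.
Proof.
move=> UE e; have [|n fn] := @const_sect_eq0 f U UE (a - b).
  by have -> := raddfB (const_mor U); rewrite /= e subrr.
by exists n; apply/eqP; rewrite -subr_eq0 -mulrBr fn.
Qed.

(* A partition of unity: on finitely many [D (h i)] covering [D f], the section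
   is [a i / h i] with [h i * a j = h j * a i]. *)
Lemma const_sect_basic (f : A) (U : set (spec A)) (s : spec_sect U) :
    (forall q : spec A, U q <-> ~ q f) ->
  exists n a, const_sect U a = const_sect U (f ^+ n) * s.
Proof.
move=> UE.
(* The denominators [h] for which [s] is a single fraction [a / h] on the whole basic open of
   [h]. *)
pose H := [set h | exists a, forall q : spec A, ~ q h -> s q a h].
have covH p : prime_ideal p -> ~ p f -> exists2 h, H h & ~ p h.
  move=> pp pf; have Uq : U (Spec pp) by apply/UE.
  have [g [a [b [qg gs]]]] := germ_local s Uq; have /= pb := germ_den (gs _ Uq qg).
  exists (f * g * b).
    exists (f * g * a) => q qfgb; have pq := ideal_at_prime q.
    have qfg := prime_idealMr pq qfgb.
    apply: germ_trans (gs q _ (prime_idealMl pq qfg)) qfgb _.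
      by apply/UE; apply: prime_idealMr pq qfg.
    by apply: same_frac_eq; ring.
  by do ?apply: (prime_idealM pp).
have [n0 [m [c0 [h [Hh fE]]]]] := prime_cover covH.
have [a ha] := choice Hh.
have cov (q : spec A) : ~ q f -> exists i, ~ q (h i).
  move=> qf; apply: contrapT => /forallNP qh; have pq := ideal_at_prime q.
  apply: (prime_idealX (n := n0) pq qf); rewrite fE.
  elim/big_ind: _ => [||i _]; [by case: pq|by case: pq|].
  by apply: prime_ideal_mull => //; apply: contrapT.
(* Two fractions for [s] agree on the overlap, but the cross products agree only after
   multiplication by a power of [h i * h j]. *)
have comp ij : exists n, (h ij.1 * h ij.2) ^+ n * (a ij.1 * h ij.2) =
    (h ij.1 * h ij.2) ^+ n * (a ij.2 * h ij.1).
  case: ij => i j /=; pose W : set (spec A) := [set q | ~ q (h i * h j)].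
  apply: (@const_sect_eq _ W) => //; apply: spec_sect_ext => q Wq.
  exists (a i * h j), 1, (a j * h i), 1.
  split; [exact: const_sectE|exact: const_sectE|].
  have pq := ideal_at_prime q.
  have [t qt e] := germ_same (ha i q (prime_idealMr pq Wq)) (ha j q (prime_idealMl pq Wq)).
  by exists t; rewrite // !mulr1.
(* A common exponent for the finitely many pairs. Rewriting [a i / h i] as
   [(h i ^+ N * a i) / h i ^+ N.+1] absorbs it, and the cross products become equal. *)
have [e eP] := choice comp; pose N := \max_ij e ij.
pose h' i := h i ^+ N.+1; pose a' i := h i ^+ N * a i.
have h'a' i j : h' i * a' j = h' j * a' i.
  have eN : (e (i, j) <= N)%N := leq_bigmax _; move: (eP (i, j)) => /= eij.
  have {eij} : (h i * h j) ^+ N * (a i * h j) = (h i * h j) ^+ N * (a j * h i).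
    by rewrite -(subnK eN) exprD -!mulrA eij.
  by rewrite exprMn_comm ?/h' ?/a' ?exprS => [e'|]; [ring: e'|exact: mulrC].
have sa' i (q : spec A) : ~ q (h i) -> s q (a' i) (h' i).
  move=> qh; apply: germ_trans (ha i q qh) (prime_idealX (ideal_at_prime q) qh) _.
  by apply: same_frac_eq; rewrite /h' /a' exprS; ring.
have covH' p : prime_ideal p -> ~ p f -> exists2 x, range h' x & ~ p x.
  move=> pp pf; have [i pi] := cov (Spec pp) pf.
  by exists (h' i); [exists i|apply: (prime_idealX pp)].
have [n [l [c1 [g [gP fnE]]]]] := prime_cover covH'.
have [j|r rE] := @choice _ _ (fun j i => h' i = g j).
  by have [i _ <-] := gP j; exists i.
(* The numerator copies the expression of [f ^+ n] as a combination of the [h'], each [h'] being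
   replaced by its [a']. *)
exists n, (\sum_j c1 j * a' (r j)); apply: spec_sect_ext => q Uq.
have [i qi] := cov q (iffLR (UE q) Uq).
exists (\sum_j c1 j * a' (r j)), 1, (f ^+ n * a' i), (1 * h' i).
split; first exact: const_sectE.
  by apply: germM; [apply: const_sectE|apply: sa'].
apply: same_frac_eq; rewrite mul1r mulr1 fnE !big_distrl; apply: eq_bigr => j _ /=.
by rewrite -rE -[LHS]mulrA -[RHS]mulrA -(h'a' i (r j)) [a' _ * _]mulrC.
Qed.

End SpecSpace.

(** * The spectrum as a scheme *)

Section SpecScheme.
Variables (k : fieldType) (A : comPzRingType) (c : {rmorphism k -> A}).

Lemma const_sectT_surj (s : spec_sect [set: spec A]) :
  exists a, s = const_sect setT a.
Proof.
have [|n [a e]] := const_sect_basic (f := 1) s.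
  by move=> q; split=> // _; apply: prime_idealN1 (ideal_at_prime q).
by exists a; rewrite e expr1n (rmorph1 (const_mor _)) mul1r.
Qed.

Lemma preim_prime (B C : comPzRingType) (f : {rmorphism B -> C}) (p : set C) :
  prime_ideal p -> prime_ideal (f @^-1` p).
Proof.
move=> [p0 pD pM p1 pP]; split=> /=; rewrite ?rmorph0 ?rmorph1 //.
- by move=> a b pa pb; rewrite rmorphD; apply: pD.
- by move=> a b pb; rewrite rmorphM; apply: pM.
- by move=> a b; rewrite rmorphM; apply: pP.
Qed.

Lemma spec_affine : affine_open (X := spec_space c) setT.
Proof.
split.
- exact: openT.
- move=> p pp; exists (Spec (preim_prime (const_mor setT) pp)) => //.
  apply/seteqP; split=> s /=; have [a ->] := const_sectT_surj s.
    by move=> pa /(germ_unit_const c _ openT I); apply.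
  by move=> npa; apply: contrapT => pa; apply: npa; apply/(germ_unit_const c _ openT I).
- move=> x y _ _ xy; apply: spec_eq => a; have /= := xy (const_sect setT a).
  have /= xa := @germ_unit_const _ _ c setT a x openT I.
  have /= ya := @germ_unit_const _ _ c setT a y openT I.
  by rewrite xa ya => e; split=> h; apply: contrapT => /e.
- move=> W x oW _ /oW[g xg gW]; exists (const_sect setT g).
  split; first by apply/(germ_unit_const c _ openT I).
  by move=> y /(germ_unit_const c _ openT I); apply: gW.
- move=> f; have [a fa] := const_sectT_surj f.
  have UE q : basic_open (X := spec_space c) (f : sect (spec_space c) setT) q <-> ~ q a.
    by rewrite fa; apply: (germ_unit_const c _ openT).
  have resE x : res (@basic_open_sub k (spec_space c) setT f) (const_sect setT x) =
      const_sect _ x by apply: restr_const.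
  split=> s.
    have [x ->] := const_sectT_surj s; rewrite resE => x0.
    have [n nx] := const_sect_eq0 UE x0.
    exists n; rewrite fa -(rmorphXn (const_mor _)) -(rmorphM (const_mor _)) nx.
    exact: (rmorph0 (const_mor _)).
  have [n [x xE]] := const_sect_basic (s : spec_sect _) UE.
  exists n, (const_sect setT x); rewrite resE xE.
  have := resE (a ^+ n); rewrite (rmorphXn (const_mor _)) /= -fa => ->.
  by rewrite (rmorphXn (const_mor _)).
Qed.

Definition spec_scheme : scheme k :=
  @Scheme k (spec_space c) (@spec_space_local A k c)
    (fun x => ex_intro2 _ _ setT spec_affine I).

End SpecScheme.

(** * Units in the stalks of a scheme *)

Section Germs.
Variables (k : fieldType) (X : scheme k).
Implicit Types U V W : set X.

Lemma open_local U : (forall x, U x -> exists V, [/\ open V, V x & V `<=` U]) -> open U.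
Proof.
move=> loc; rewrite openE => x /loc[V [oV Vx VU]].
by rewrite /interior /= nbhsE; exists V.
Qed.

Lemma germ_unit_res U V (VU : V `<=` U) (s : sect X U) x :
  open U -> open V -> V x -> germ_unit (res VU s) x <-> germ_unit s x.
Proof.
move=> oU oV Vx; split.
  move=> [W [WV [oW Wx [t st]]]]; have WU := subset_trans WV VU.
  by exists W, WU; split=> //; exists t; rewrite -st (res_res VU WV WU).
move=> [W [WU [oW Wx [t st]]]]; exists (W `&` V), (@subIsetr _ W V).
have oWV := openI oW oV; split=> //; exists (res (@subIsetl _ W V) t).
have VWU : W `&` V `<=` U by move=> y [_ /VU].
rewrite (res_res VU (@subIsetr _ W V) VWU) // -(res_res WU (@subIsetl _ W V) VWU) //.
by rewrite -rmorphM st rmorph1.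
Qed.

Lemma germ_unit_inv U (s t : sect X U) x : open U -> U x -> s * t = 1 -> germ_unit s x.
Proof. by move=> oU Ux st; exists U, (@subset_refl _ U); split=> //; exists t; rewrite res_id. Qed.

Lemma germ_unit1 U x : open U -> U x -> germ_unit (1 : sect X U) x.
Proof. by move=> oU Ux; apply: (germ_unit_inv (t := 1)); rewrite ?mulr1. Qed.

Lemma germ_unitM U (s t : sect X U) x : open U ->
  germ_unit (s * t) x <-> germ_unit s x /\ germ_unit t x.
Proof.
move=> oU; split.
  move=> [V [VU [oV Vx [u stu]]]].
  split; exists V, VU; split=> //.
    by exists (res VU t * u); rewrite mulrA -rmorphM.
  by exists (res VU s * u); rewrite mulrCA mulrA -rmorphM.
move=> [[V [VU [oV Vx [u su]]]] [W [WU [oW Wx [v tv]]]]].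
have VWU : V `&` W `<=` U by move=> y [/VU].
have oVW := openI oV oW.
exists (V `&` W), VWU; split=> //.
exists (res (@subIsetl _ V W) u * res (@subIsetr _ V W) v).
rewrite rmorphM mulrACA -(res_res VU (@subIsetl _ V W) VWU) //.
by rewrite -(res_res WU (@subIsetr _ V W) VWU) // -!rmorphM su tv !rmorph1 mulr1.
Qed.

Lemma germ_unitX U (s : sect X U) n x : open U -> U x ->
  germ_unit s x -> germ_unit (s ^+ n) x.
Proof.
move=> oU Ux su; elim: n => [|n IH]; first by rewrite expr0; apply: germ_unit1.
by rewrite exprS; apply/germ_unitM.
Qed.

Lemma germ_unit0 U x : open U -> ~ germ_unit (0 : sect X U) x.
Proof.
move=> oU [V [VU [oV Vx [t]]]]; rewrite rmorph0 mul0r => e.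
by have [/(_ (esym e))] := scheme_local oV Vx.
Qed.

Lemma germ_unit_prime U x : open U -> U x ->
  prime_ideal [set s : sect X U | ~ germ_unit s x].
Proof.
move=> oU Ux; split=> /=.
- exact: germ_unit0.
- move=> a b na nb ab; have [_ /(_ _ _ ab)[]//] := scheme_local oU Ux.
- by move=> a b nb /(germ_unitM _ _ _ oU)[].
- by apply; apply: germ_unit1.
- move=> a b nab; apply: contrapT => /not_orP[/contrapT ua /contrapT ub].
  by apply: nab; apply/germ_unitM.
Qed.

Lemma open_basic_open U (s : sect X U) : open U -> open (basic_open s).
Proof.
move=> oU; apply: open_local => x [V [VU [oV Vx [t st]]]]; exists V; split=> //.
by move=> y Vy; exists V, VU; split=> //; exists t.
Qed.

Lemma inverse_unique (A : comPzRingType) (a b b' : A) : a * b = 1 -> a * b' = 1 -> b = b'.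
Proof. by move=> ab ab'; rewrite -[b]mulr1 -ab' mulrA [b * a]mulrC ab mul1r. Qed.

(** Inverses are unique, so the local ones agree on overlaps and glue. *)
Lemma unit_glue U (s : sect X U) : open U -> (forall x, U x -> germ_unit s x) ->
  exists t, s * t = 1.
Proof.
move=> oU su; pose I := {x : X | U x}.
have /choice[V VP] (i : I) : exists V : set X, exists VU : V `<=` U,
    [/\ open V, V (sval i) & exists t : sect X V, res VU s * t = 1].
  exact: su (svalP i).
have VU i : V i `<=` U by case: (VP i).
have oV i : open (V i) by case: (VP i) => ? [].
have inv i : exists t : sect X (V i), res (VU i) s * t = 1.
  case: (VP i) => VU' [_ _ [t st]]; exists t; rewrite -st.
  by congr (res _ s * t); apply: Prop_irrelevance.
pose t i := sval (cid (inv i)).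
have tP i : res (VU i) s * t i = 1 by exact: svalP (cid (inv i)).
have cov : U `<=` \bigcup_i V i.
  by move=> x Ux; exists (exist _ x Ux) => //; case: (VP (exist _ x Ux)) => ? [].
have [|u uP] := sheaf_glue VU (s := t) oU oV cov.
  move=> i j Wi Wj; have oW := openI (oV i) (oV j).
  have WU : V i `&` V j `<=` U by move=> x [/VU].
  apply: (inverse_unique (a := res WU s)).
    by rewrite -(res_res (VU i) Wi) // -rmorphM tP rmorph1.
  by rewrite -(res_res (VU j) Wj) // -rmorphM tP rmorph1.
exists u; apply: (sheaf_sep (VU := VU)) => // i.
by rewrite rmorphM uP tP rmorph1.
Qed.

Lemma res_basic_unit U (s : sect X U) : open U ->
  exists t, res (@basic_open_sub _ X U s) s * t = 1.
Proof.
move=> oU; apply: unit_glue; first exact: open_basic_open.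
by move=> x sx; apply/germ_unit_res => //; apply: open_basic_open.
Qed.

End Germs.

(** * Affine charts and morphisms from spectra *)

Section Charts.
Variables (k : fieldType) (X : scheme k).

(* The germ of [s] at [x] is the fraction [b / d]. *)
Definition represents (U : set X) (B : comPzRingType) (e : {rmorphism B -> sect X U})
    (V : set X) (s : sect X V) (x : X) (b d : B) : Prop :=
  germ_unit (e d) x /\
  exists (N : set X) (NV : N `<=` V) (NU : N `<=` U),
    [/\ open N, N x & res NU (e b) = res NV s * res NU (e d)].

(* [e] identifies [U] with the spectrum of [B]; [chart_frac] and [chart_zero]
   say that the stalks are the localizations of [B]. *)
Record chart (U : set X) (B : comPzRingType) (e : {rmorphism B -> sect X U}) : Prop :=
  Chart {
    chart_open : open U;
    chart_point : forall p : set B, prime_ideal p ->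
      exists2 x, U x & forall b, p b <-> ~ germ_unit (e b) x;
    chart_inj : forall x y, U x -> U y ->
      (forall b, germ_unit (e b) x <-> germ_unit (e b) y) -> x = y;
    chart_basis : forall (V : set X) x, open V -> V x -> U x ->
      exists2 b, germ_unit (e b) x & basic_open (e b) `<=` V;
    chart_frac : forall (V : set X) (s : sect X V) x, open V -> V x -> U x ->
      exists b d, represents e s x b d;
    chart_zero : forall (N : set X) (NU : N `<=` U) b x, open N -> N x ->
      res NU (e b) = 0 -> exists2 t, germ_unit (e t) x & t * b = 0
  }.

Section Represents.
Variables (U : set X) (B : comPzRingType) (e : {rmorphism B -> sect X U}).
Hypothesis ch : chart e.
Let oU := chart_open ch.

Lemma represents_dom (V : set X) (s : sect X V) x b d : represents e s x b d -> U x /\ V x.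
Proof. by move=> [_ [N [NV [NU [_ Nx _]]]]]; split; [apply: NU|apply: NV]. Qed.

Lemma represents_same (V : set X) (s : sect X V) x b d b' d' : open V ->
  represents e s x b d -> represents e s x b' d' ->
  exists2 t, germ_unit (e t) x & t * (b * d') = t * (b' * d).
Proof.
move=> oV [_ [N [NV [NU [oN Nx sN]]]]] [_ [N' [NV' [NU' [oN' Nx' sN']]]]].
have MU : N `&` N' `<=` U by move=> y [/NU].
have MV : N `&` N' `<=` V by move=> y [/NV].
have oM := openI oN oN'.
have [|t te tE] := chart_zero ch (NU := MU) (b := b * d' - b' * d) oM (conj Nx Nx').
  have toN y : res MU y = res (@subIsetl _ N N') (res NU y) by rewrite (res_res NU _ MU).
  have toN' y : res MU y = res (@subIsetr _ N N') (res NU' y) by rewrite (res_res NU' _ MU).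
  have sN1 : res MU (e b) = res MV s * res MU (e d).
    by rewrite !toN sN rmorphM (res_res NV _ MV).
  have sN2 : res MU (e b') = res MV s * res MU (e d').
    by rewrite !toN' sN' rmorphM (res_res NV' _ MV).
  by rewrite !rmorphB !rmorphM /= sN1 sN2; ring.
by exists t => //; apply/eqP; rewrite -subr_eq0 -mulrBr tE.
Qed.

Lemma represents_local (V : set X) (s : sect X V) x b d : open V ->
  represents e s x b d -> exists2 g, germ_unit (e g) x &
    forall y, germ_unit (e g) y -> represents e s y b d.
Proof.
move=> oV [dx [N [NV [NU [oN Nx sN]]]]].
have oNd := openI oN (open_basic_open (e d) oU).
have [g gx gN] := chart_basis ch oNd (conj Nx dx) (NU _ Nx).
by exists g => // y /gN[Ny dy]; split=> //; exists N, NV, NU.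
Qed.

Lemma represents_unit (V : set X) (s : sect X V) x b d : open V ->
  represents e s x b d -> germ_unit s x <-> germ_unit (e b) x.
Proof.
move=> oV [dx [N [NV [NU [oN Nx sN]]]]].
rewrite -(germ_unit_res NU (e b) oU oN Nx) sN (germ_unitM _ _ _ oN).
rewrite (germ_unit_res NV s oV oN Nx) (germ_unit_res NU (e d) oU oN Nx).
by split=> [|[]].
Qed.

Lemma represents_res (V W : set X) (WV : W `<=` V) (s : sect X V) x b d :
  open V -> open W -> W x -> represents e s x b d -> represents e (res WV s) x b d.
Proof.
move=> oV oW Wx [dx [N [NV [NU [oN Nx sN]]]]]; split=> //.
have MU : N `&` W `<=` U by move=> y [/NU].
have MV : N `&` W `<=` V by move=> y [/NV].
exists (N `&` W), (@subIsetr _ N W), MU; split=> //; first exact: openI.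
rewrite (res_res WV _ MV) // -?(res_res NU (@subIsetl _ N W) MU) //; try exact: openI.
by rewrite sN rmorphM (res_res NV _ MV) //; apply: openI.
Qed.

Lemma represents_const b x : U x -> represents e (e b) x b 1.
Proof.
move=> Ux; split; first by rewrite rmorph1; apply: germ_unit1.
by exists U, (@subset_refl _ U), (@subset_refl _ U); rewrite !rmorph1 mulr1.
Qed.

Lemma representsW (V : set X) (s : sect X V) b x (VU : V `<=` U) :
  open V -> V x -> res VU (e b) = s -> represents e s x b 1.
Proof.
move=> oV Vx es; split; first by rewrite rmorph1; apply: germ_unit1 => //; apply: (VU).
by exists V, (@subset_refl _ V), VU; rewrite !rmorph1 mulr1 es res_id.
Qed.

Lemma represents1 (V : set X) x : open V -> V x -> U x -> represents e (1 : sect X V) x 1 1.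
Proof.
move=> oV Vx Ux; split; first by rewrite rmorph1; apply: germ_unit1.
exists (V `&` U), (@subIsetl _ V U), (@subIsetr _ V U).
by rewrite !rmorph1 mulr1; split=> //; apply: openI.
Qed.

Section Binary.
Variables (V : set X) (s t : sect X V) (x : X) (b d b' d' : B).
Hypotheses (oV : open V) (sx : represents e s x b d) (tx : represents e t x b' d').

Lemma represents_binary (n : B) (u : sect X V) :
    (forall (M : set X) (MU : M `<=` U) (MV : M `<=` V),
       res MU (e b) = res MV s * res MU (e d) ->
       res MU (e b') = res MV t * res MU (e d') ->
       res MU (e n) = res MV u * (res MU (e d) * res MU (e d'))) ->
  represents e u x n (d * d').
Proof.
case: sx tx => dx [N [NV [NU [oN Nx sN]]]] [dx' [N' [NV' [NU' [oN' Nx' sN']]]]] nE.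
split; first by rewrite rmorphM; apply/germ_unitM.
have MU : N `&` N' `<=` U by move=> y [/NU].
have MV : N `&` N' `<=` V by move=> y [/NV].
have oM := openI oN oN'.
exists (N `&` N'), MV, MU; split=> //; rewrite !rmorphM; apply: nE.
  by rewrite -!(res_res NU (@subIsetl _ N N') MU) // sN rmorphM (res_res NV _ MV).
by rewrite -!(res_res NU' (@subIsetr _ N N') MU) // sN' rmorphM (res_res NV' _ MV).
Qed.

Lemma representsB : represents e (s - t) x (b * d' - b' * d) (d * d').
Proof.
apply: represents_binary => M MU MV es et.
by rewrite !rmorphB !rmorphM /= es et; ring.
Qed.

Lemma representsM : represents e (s * t) x (b * b') (d * d').
Proof.
by apply: represents_binary => M MU MV es et; rewrite !rmorphM /= es et; ring.
Qed.

End Binary.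
End Represents.
End Charts.

Section SpecChart.
Variables (k : fieldType) (A : comPzRingType) (c : {rmorphism k -> A}).

(** The chart is by [A] itself and not by the global sections, so that a ring morphism out of [A]
    directly induces a morphism into its spectrum. *)
Lemma spec_chart :
  chart (X := spec_scheme c) (U := setT) (const_mor [set: spec A]).
Proof.
split.
- exact: openT.
- move=> p pp; exists (Spec pp) => // a.
  have := @germ_unit_const _ _ c setT a (Spec pp) openT I => /= ->.
  by split=> [pa npa|/contrapT].
- move=> x y _ _ xy; apply: spec_eq => a; have /= := xy a.
  have /= -> := @germ_unit_const _ _ c setT a x openT I.
  have /= -> := @germ_unit_const _ _ c setT a y openT I.
  by move=> e; split=> h; apply: contrapT => /e.
- move=> V x oV Vx _; have [g xg gV] := oV x Vx; exists g.
    exact/(germ_unit_const c _ openT I).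
  by move=> y /(germ_unit_const c _ openT I); apply: gV.
- move=> V s x oV Vx _; have [g [a [b [xg gs]]]] := germ_local (s : spec_sect V) Vx.
  exists a, b; split.
    by apply/(germ_unit_const c _ openT I); apply: germ_den (gs _ Vx xg).
  pose N := [set q : spec A | V q /\ ~ q g].
  have NV : N `<=` V by move=> q [].
  exists N, NV, (@subsetT _ N); split=> //.
    move=> q [/oV[h qh hV] qg]; exists (h * g); first exact: prime_idealM (ideal_at_prime q) qh qg.
    move=> q' qhg; split; first exact: hV (prime_idealMr (ideal_at_prime q') qhg).
    exact: prime_idealMl (ideal_at_prime q') qhg.
  apply: spec_sect_ext => q Nq; exists a, 1, (a * b), (b * 1).
  split; last by apply: same_frac_eq; ring.
    by apply: restr_sectE => //; apply: const_sectE.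
  case: (Nq) => Vq qg; apply: germM; apply: restr_sectE => //; first exact: gs.
  exact: const_sectE.
- move=> N NU b x oN Nx /= b0.
  have h : restr_mor NU (const_sect setT b) x b 1.
    by apply: restr_sectE => //; apply: const_sectE.
  have [t xt e] : same_frac x b 1 0 1.
    apply: (@germ_same _ N (restr_mor NU (const_sect setT b))) h _.
    by have -> : restr_mor NU (const_sect setT b) = 0 := b0; apply: germ0.
  exists t; first exact/(germ_unit_const c _ openT I).
  by move: e; rewrite mulr1 mul0r mulr0.
Qed.

End SpecChart.

Section AffineChart.
Variables (k : fieldType) (X : scheme k).

(** The conditions on [U] concern its own ring of sections. They pass to the basic open of [a]
    because each section there becomes, after multiplication by a power of [a], the restriction of a
    section on [U]. *)
Lemma basic_chart (U : set X) (a : sect X U) : affine_open U ->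
  chart (@idfun (sect X (basic_open a)) : {rmorphism _ -> _}).
Proof.
move=> [oU Upt Uinj Ubasis Uloc]; set D := basic_open a.
have oD : open D := open_basic_open a oU.
pose r : {rmorphism sect X U -> sect X D} := res (@basic_open_sub _ X U a).
have DU : D `<=` U := @basic_open_sub _ X U a.
have rE (V : set X) (VD : V `<=` D) (VU : V `<=` U) s : open V -> res VD (r s) = res VU s.
  by move=> oV; rewrite (res_res _ _ VU).
have runit x s : D x -> germ_unit (r s) x <-> germ_unit s x.
  by move=> Dx; apply: germ_unit_res.
have rX x n : D x -> germ_unit (r (a ^+ n)) x.
  by move=> Dx; apply/runit => //; apply: germ_unitX => //; apply: DU.
have [ai aE] := res_basic_unit a oU.
split=> //=.
(* A prime of the sections on [D] is pulled back to [U], where it is a point [x]. As [a] is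
   invertible on [D], the pullback misses [a], which puts [x] in [D]; clearing the denominator shows
   that [x] also describes [p]. *)
- move=> p pp; have [x Ux px] := Upt _ (preim_prime r pp).
  have pE b : p (r b) <-> ~ germ_unit b x by rewrite -[p (r b)]/((r @^-1` p) b) px.
  have npa n : ~ p (r (a ^+ n)).
    rewrite rmorphXn; apply: (prime_idealX pp) => pa; apply: (prime_idealN1 pp).
    by rewrite -aE; apply: prime_ideal_mulr.
  have Dx : D x by apply: contrapT => /pE pa; apply: (npa 1%N); rewrite expr1.
  exists x => // s; have [_ /(_ s)[n [b bE]]] := Uloc a.
  have psE : p s <-> p (r b).
    rewrite /r bE; split; first exact: prime_ideal_mull.
    by have [_ _ _ _ pM] := pp => /pM[/npa|].
  rewrite psE pE -(runit x b Dx) {1}/r bE (germ_unitM _ _ _ oD).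
  by split=> [h us|h [_ us]]; apply: h => //; split=> //; apply: rX.
- move=> x y Dx Dy xy; apply: Uinj; [exact: DU|exact: DU|] => s.
  by rewrite -(runit x) // -(runit y).
- move=> V x oV Vx Dx; have oVD := openI oV oD.
  have VDU : V `&` D `<=` U by move=> y [_ /DU].
  have [f [fx fV]] := Ubasis _ x oVD VDU (conj Vx Dx).
  exists (r f); first exact/runit.
  move=> y fy; have Dy : D y by exact: basic_open_sub fy.
  by have [] : (V `&` D) y by apply: fV; apply/(runit y f Dy).
- move=> V s x oV Vx Dx; have oVD := openI oV oD.
  have VDU : V `&` D `<=` U by move=> y [_ /DU].
  have [f [fx fV]] := Ubasis _ x oVD VDU (conj Vx Dx).
  have fV1 : basic_open f `<=` V by move=> y /fV[].
  have fD : basic_open f `<=` D by move=> y /fV[].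
  have ofo := open_basic_open f oU.
  have [_ /(_ (res fV1 s))[n [b bE]]] := Uloc f.
  exists (r b), (r (f ^+ n)); split.
    by apply/runit => //; apply: germ_unitX => //; apply: DU.
  exists (basic_open f), fV1, fD; split=> //.
  by rewrite !(rE _ _ (@basic_open_sub _ X U f)) // bE mulrC.
- move=> N NU u x oN Nx u0; have NUU : N `<=` U by move=> y /NU/DU.
  have [_ /(_ u)[n [b bE]]] := Uloc a.
  have [f [fx fN]] := Ubasis N x oN NUU Nx.
  have ofo := open_basic_open f oU.
  have fD : basic_open f `<=` D by move=> y /fN/NU.
  have [Uf _] := Uloc f; have [|m mb] := Uf b.
    rewrite -(rE _ fD _ b ofo) /r bE rmorphM -(res_res NU fN fD u) //.
    by rewrite u0 rmorph0 mulr0.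
  exists (r (f ^+ m) * r (a ^+ n)).
    apply/germ_unitM => //; split; last by apply: rX; apply: (NU).
    by apply/runit; [apply: (NU)|apply: germ_unitX => //; apply: NUU].
  by rewrite -mulrA -[r (a ^+ n) * u]bE -[res _ b]/(r b) -rmorphM mb rmorph0.
Qed.

Lemma chart_nbhd (W : set X) x : open W -> W x ->
  exists D : set X, [/\ chart (@idfun (sect X D) : {rmorphism _ -> _}), D x & D `<=` W].
Proof.
move=> oW Wx; have [U affU Ux] := scheme_affine x.
have [oU _ _ Ubasis _] := affU.
have [f [fx fW]] := Ubasis _ x (openI oW oU) (@subIsetr _ W U) (conj Wx Ux).
by exists (basic_open f); split; [exact: basic_chart|exact: fx|move=> y /fW[]].
Qed.

End AffineChart.

(** * Morphisms from a spectrum into a chart *)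

Section SpecMorphism.
Variables (k : fieldType) (X : scheme k) (U : set X) (B : comPzRingType).
Variables (e : {rmorphism B -> sect X U}) (ch : chart e).
Variables (A : comPzRingType) (c : {rmorphism k -> A}) (f : {rmorphism B -> A}).
Hypothesis f_cst : forall x : k, exists2 b, e b = cst X U x & f b = c x.

Lemma spec_map_subproof (p : spec A) :
  exists2 x, U x & forall b, p (f b) <-> ~ germ_unit (e b) x.
Proof.
by have [x Ux px] := chart_point ch (preim_prime f (ideal_at_prime p)); exists x.
Qed.

Definition spec_map (p : spec_scheme c) : X := sval (cid2 (spec_map_subproof p)).

Lemma spec_map_dom p : U (spec_map p).
Proof. by rewrite /spec_map; case: cid2. Qed.

Lemma spec_mapN (p : spec_scheme c) b : (p : spec A) (f b) <-> ~ germ_unit (e b) (spec_map p).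
Proof. by rewrite /spec_map; case: cid2. Qed.

Lemma spec_mapP (p : spec_scheme c) b : ~ (p : spec A) (f b) <-> germ_unit (e b) (spec_map p).
Proof. by rewrite spec_mapN; split=> [/contrapT|u nu]; last exact: nu. Qed.

Lemma spec_map_cont : continuous spec_map.
Proof.
apply/continuousP => V oV; suff: spec_open (spec_map @^-1` V) by []; move=> p Vp.
have [b bp bV] := chart_basis ch oV Vp (spec_map_dom p).
by exists (f b); [apply/spec_mapP|move=> q /spec_mapP /bV].
Qed.

Section Pull.
Variables (V : set X) (oV : open V).

Let r (s : sect X V) (q : spec A) (x y : A) :=
  exists b d, [/\ represents e s (spec_map q) b d, x = f b & y = f d].

Let r_dom s (q : spec A) x y : r s q x y -> (spec_map @^-1` V) q /\ ~ q y.
Proof.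
move=> [b [d [sbd _ ->]]]; split; first by have [] := represents_dom sbd.
by apply/spec_mapP; case: sbd.
Qed.

Let r_same s (q : spec A) x y z w : r s q x y -> r s q z w -> same_frac q x y z w.
Proof.
move=> [b [d [sbd -> ->]]] [b' [d' [sbd' -> ->]]].
have [t tq tE] := represents_same ch oV sbd sbd'.
by exists (f t); [apply/spec_mapP|rewrite -!rmorphM tE].
Qed.

Let r_local s (q : spec A) : (spec_map @^-1` V) q -> exists g x y, ~ q g /\
  forall q' : spec A, (spec_map @^-1` V) q' -> ~ q' g -> r s q' x y.
Proof.
move=> Vq; have [b [d sbd]] := chart_frac ch s oV Vq (spec_map_dom q).
have [g gq gs] := represents_local ch oV sbd.
exists (f g), (f b), (f d); split=> [|q' Vq' /spec_mapP gq']; first exact/spec_mapP.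
by exists b, d; split=> //; apply: gs.
Qed.

(** The germ [b / d] of [s] goes to [f b / f d]. Independence of the fraction rests on [chart_zero]:
    the element annihilating the difference is a unit at the image point, so its image under [f]
    avoids the prime. *)
Definition spec_pull (s : sect X V) : spec_sect (spec_map @^-1` V) :=
  make_sect (@r_dom s) (@r_same s) (@r_local s).

Lemma spec_pullE s (q : spec A) b d : represents e s (spec_map q) b d ->
  spec_pull s q (f b) (f d).
Proof. by move=> sbd; apply: make_sectE; exists b, d. Qed.

Lemma spec_pullB : zmod_morphism spec_pull.
Proof.
move=> s t; apply: spec_sect_ext => q Vq.
have [b [d sbd]] := chart_frac ch s oV Vq (spec_map_dom q).
have [b' [d' tbd]] := chart_frac ch t oV Vq (spec_map_dom q).
exists (f (b * d' - b' * d)), (f (d * d')), (f b * f d' + - f b' * f d), (f d * f d').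
split; last by apply: same_frac_eq; rewrite rmorphB !rmorphM; ring.
  exact/spec_pullE/representsB.
by apply: germD; [|apply: germN]; apply: spec_pullE.
Qed.

Lemma spec_pullM : monoid_morphism spec_pull.
Proof.
split=> [|s t]; apply: spec_sect_ext => q Vq.
  exists (f 1), (f 1), 1, 1; split; last by apply: same_frac_eq; rewrite rmorph1.
    by apply: spec_pullE; apply: represents1 => //; apply: spec_map_dom.
  exact: germ1.
have [b [d sbd]] := chart_frac ch s oV Vq (spec_map_dom q).
have [b' [d' tbd]] := chart_frac ch t oV Vq (spec_map_dom q).
exists (f (b * b')), (f (d * d')), (f b * f b'), (f d * f d').
split; last by apply: same_frac_eq; rewrite !rmorphM; ring.
  exact/spec_pullE/representsM.
by apply: germM; apply: spec_pullE.
Qed.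

HB.instance Definition _ := GRing.isZmodMorphism.Build (sect X V)
  (spec_sect (spec_map @^-1` V)) spec_pull spec_pullB.
HB.instance Definition _ := GRing.isMonoidMorphism.Build (sect X V)
  (spec_sect (spec_map @^-1` V)) spec_pull spec_pullM.

Definition spec_pull_mor :
    {rmorphism sect X V -> sect (spec_scheme c) (spec_map @^-1` V)} :=
  (spec_pull : {rmorphism sect X V -> spec_sect (spec_map @^-1` V)}).

End Pull.

Lemma spec_pull_res (V W : set X) (oV : open V) (oW : open W) (WV : W `<=` V)
    (fWV : spec_map @^-1` W `<=` spec_map @^-1` V) (s : sect X V) :
  res fWV (spec_pull_mor oV s) = spec_pull_mor oW (res WV s).
Proof.
apply: spec_sect_ext => q Wq.
have [b [d sbd]] := chart_frac ch s oV (WV _ Wq) (spec_map_dom q).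
exists (f b), (f d), (f b), (f d); split; last exact: same_frac_eq.
  by apply: restr_sectE => //; apply: spec_pullE.
by apply: spec_pullE; apply: represents_res.
Qed.

Lemma spec_pull_cst (V : set X) (oV : open V) (a : k) :
  spec_pull_mor oV (cst X V a) = cst (spec_scheme c) _ a.
Proof.
apply: spec_sect_ext => q Vq; have [b eb fb] := f_cst a.
exists (f b), (f 1), (c a), 1; split; last by apply: same_frac_eq; rewrite fb rmorph1.
  apply: spec_pullE; have Uq := spec_map_dom q.
  have oVU := openI oV (chart_open ch).
  split; first by rewrite rmorph1; apply: germ_unit1 => //; exact: chart_open ch.
  exists (V `&` U), (@subIsetl _ V U), (@subIsetr _ V U); split=> //.
  by rewrite eb !rmorph1 mulr1 !res_cst //; exact: chart_open ch.
exact: const_sectE.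
Qed.

Lemma spec_pull_local (V : set X) (oV : open V) (s : sect X V) (q : spec_scheme c) :
  V (spec_map q) -> germ_unit (spec_pull_mor oV s) q -> germ_unit s (spec_map q).
Proof.
move=> Vq; have oW : open (spec_map @^-1` V) by have /continuousP := spec_map_cont; apply.
have [b [d sbd]] := chart_frac ch s oV Vq (spec_map_dom q).
move=> /(germ_unit_specP c _ _ oW)[x [y [sxy qx]]].
apply/(represents_unit ch oV sbd)/spec_mapP.
have sq : spec_pull oV s q (f b) (f d) by apply: spec_pullE.
have [t qt tE] := germ_same sxy sq.
have pq := ideal_at_prime q; have qd := germ_den sq => qb.
apply: (prime_idealM pq qt (prime_idealM pq qx qd)).
by rewrite tE; apply: prime_ideal_mull => //; apply: prime_ideal_mulr.
Qed.

(** The ring [B] of a chart carries no structure map from [k], hence the form of [f_cst]: each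
    constant has a preimage in [B] that [f] sends to the same constant. *)
Definition spec_mor : morphism (spec_scheme c) X :=
  Morphism spec_map_cont spec_pull_res spec_pull_cst spec_pull_local.

Lemma spec_mor_dom p : U (spec_mor p).
Proof. exact: spec_map_dom. Qed.

Lemma spec_morP (p : spec_scheme c) b : germ_unit (e b) (spec_mor p) <-> ~ (p : spec A) (f b).
Proof. by rewrite spec_mapP. Qed.

Lemma spec_mor_eq (p : spec_scheme c) x : U x ->
  (forall b, germ_unit (e b) x <-> ~ (p : spec A) (f b)) -> spec_mor p = x.
Proof.
move=> Ux px; apply: (chart_inj ch) => //; first exact: spec_mor_dom.
by move=> b; rewrite px spec_morP.
Qed.

Lemma spec_mor_pull (V : set X) (oV : open V) s (q : spec A) b d :
  represents e s (spec_mor q) b d ->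
  (pull spec_mor oV s : spec_sect _) q (f b) (f d).
Proof. exact: spec_pullE. Qed.

End SpecMorphism.

Lemma mor_unit (k : fieldType) (T X : scheme k) (f : morphism T X) (V : set X)
    (oV : open V) (s : sect X V) x : V (f x) ->
  germ_unit (pull f oV s) x <-> germ_unit s (f x).
Proof.
move=> Vfx; split; first exact: pull_local.
move=> [W [WV [oW Wfx [t st]]]].
have fWV : f @^-1` W `<=` f @^-1` V by move=> y /WV.
apply/(germ_unit_res fWV) => //; [exact: open_preim|exact: open_preim|].
apply: (germ_unit_inv (t := pull f oW t)) => //; first exact: open_preim.
by rewrite (pull_res oV oW WV) -rmorphM st rmorph1.
Qed.

Section MorphismExt.
Variables (k : fieldType) (T X : scheme k) (U : set X) (B : comPzRingType).
Variables (e : {rmorphism B -> sect X U}) (ch : chart e) (f g : morphism T X).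
Let oU := chart_open ch.

(** Points of a chart are separated by which chart elements are units there, and comorphisms reflect
    and preserve units. Every section near such a point is a fraction of chart elements, so its
    pullback is determined by theirs. *)
Lemma mor_ext : (forall x, U (f x)) -> (forall x, U (g x)) ->
  (forall b (W : set T) (Wf : W `<=` f @^-1` U) (Wg : W `<=` g @^-1` U),
     open W -> res Wf (pull f oU (e b)) = res Wg (pull g oU (e b))) ->
  eq_mor f g.
Proof.
move=> Uf Ug fg.
have fgx x : f x = g x.
  apply: (chart_inj ch) => // b.
  rewrite -(mor_unit oU (e b) (Uf x)) -(mor_unit oU (e b) (Ug x)).
  have Wf : setT `<=` f @^-1` U by move=> y _; apply: Uf.
  have Wg : setT `<=` g @^-1` U by move=> y _; apply: Ug.
  rewrite -(germ_unit_res Wf _ (open_preim f oU) openT I).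
  by rewrite -(germ_unit_res Wg _ (open_preim g oU) openT I) fg //; apply: openT.
split=> // V W oV oW Wf Wg s.
have loc (i : {x | W x}) : exists M : set T, exists MW : M `<=` W,
    [/\ open M, M (sval i) &
     res MW (res Wf (pull f oV s)) = res MW (res Wg (pull g oV s))].
  case: i => x Wx /=.
  have [b [d [du [N [NV [NU [oN Nx sN]]]]]]] := chart_frac ch s oV (Wf _ Wx) (Uf x).
  (* On [N'] the denominator has an inverse [d']. The pullbacks of [d'] by [f] and [g] invert the
     same section on [M], hence coincide. *)
  pose N' := N `&` basic_open (e d).
  have oN' : open N' by apply: openI => //; apply: open_basic_open.
  have N'V : N' `<=` V by move=> y [/NV].
  have N'U : N' `<=` U by move=> y [/NU].
  have sN' : res N'U (e b) = res N'V s * res N'U (e d).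
    by rewrite -!(res_res NU (@subIsetl _ N _) N'U) // sN rmorphM (res_res NV _ N'V).
  have [d' dE] : exists d', res N'U (e d) * d' = 1.
    by apply: unit_glue => // y N'y; apply/germ_unit_res => //; case: N'y.
  pose M := W `&` (f @^-1` N' `&` g @^-1` N').
  have ofN := open_preim f oN'; have ogN := open_preim g oN'.
  have oM : open M by apply: openI => //; apply: openI.
  have MW : M `<=` W by move=> y [].
  have MfN : M `<=` f @^-1` N' by move=> y [_ []].
  have MgN : M `<=` g @^-1` N' by move=> y [_ []].
  have Mf : M `<=` f @^-1` U by move=> y /MfN /N'U.
  have Mg : M `<=` g @^-1` U by move=> y /MgN /N'U.
  have MfV : M `<=` f @^-1` V by move=> y /MfN /N'V.
  have MgV : M `<=` g @^-1` V by move=> y /MgN /N'V.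
  exists M, MW; split=> //; first by split=> //; rewrite /= -fgx; split; split.
  have sE : res N'V s = res N'U (e b) * d' by rewrite sN' -mulrA dE mulr1.
  have pullE (h : morphism T X) (MhN : M `<=` h @^-1` N') (MhU : M `<=` h @^-1` U)
      (MhV : M `<=` h @^-1` V) :
      res MhV (pull h oV s) = res MhU (pull h oU (e b)) * res MhN (pull h oN' d') /\
      res MhU (pull h oU (e d)) * res MhN (pull h oN' d') = 1.
    have hN'U : h @^-1` N' `<=` h @^-1` U by move=> y /N'U.
    have hN'V : h @^-1` N' `<=` h @^-1` V by move=> y /N'V.
    have ohN := open_preim h oN'.
    have ohU := open_preim h oU; have ohV := open_preim h oV.
    rewrite -(res_res hN'V MhN MhV) // (pull_res oV oN' N'V) sE.
    rewrite -!(res_res hN'U MhN MhU) // !(pull_res oU oN' N'U).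
    by rewrite -!rmorphM dE !rmorph1.
  have [fsE fdE] := pullE f MfN Mf MfV; have [gsE gdE] := pullE g MgN Mg MgV.
  have ofV := open_preim f oV; have ogV := open_preim g oV.
  rewrite (res_res _ _ MfV) // (res_res _ _ MgV) // fsE gsE fg //; congr (_ * _).
  apply: (inverse_unique (a := res Mf (pull f oU (e d)))) => //.
  by rewrite (fg d M Mf Mg oM).
have [M MP] := choice loc.
have MW i : M i `<=` W by case: (MP i).
apply: (sheaf_sep (V := M) (VU := MW)) => //.
- by move=> i; case: (MP i) => ? [].
- by move=> x Wx; exists (exist _ x Wx) => //; case: (MP (exist _ x Wx)) => ? [].
- move=> i; case: (MP i) => MW' [_ _]; rewrite (Prop_irrelevance MW' (MW i)); exact.
Qed.

End MorphismExt.

(** * The topology of a product *)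

Section SpanRing.
Variables (R1 R2 C : comPzRingType) (f : {rmorphism R1 -> C}) (g : {rmorphism R2 -> C}).

(** The image of the tensor product of [R1] and [R2] in [C]. Its spectrum will stand in for the
    product of two affine charts. *)
Definition span_pred : {pred C} := fun x => `[< exists n (a : 'I_n -> R1) (b : 'I_n -> R2),
  x = \sum_i f (a i) * g (b i) >].

Lemma span_predP x : reflect (exists n (a : 'I_n -> R1) (b : 'I_n -> R2),
  x = \sum_i f (a i) * g (b i)) (x \in span_pred).
Proof. exact: asboolP. Qed.

Lemma span_add x y : x \in span_pred -> y \in span_pred -> x + y \in span_pred.
Proof.
move=> /span_predP[n [a [b ->]]] /span_predP[m [a' [b' ->]]].
apply/span_predP; exists (n + m)%N,
  (fun i => match split i with inl j => a j | inr j => a' j end),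
  (fun i => match split i with inl j => b j | inr j => b' j end).
rewrite big_split_ord /=; congr (_ + _); apply: eq_bigr => i _.
  by rewrite (unsplitK (inl i)).
by rewrite (unsplitK (inr i)).
Qed.

Lemma span_mul1 u v y : y \in span_pred -> f u * g v * y \in span_pred.
Proof.
move=> /span_predP[n [a [b ->]]]; apply/span_predP.
exists n, (fun i => u * a i), (fun i => v * b i).
by rewrite big_distrr; apply: eq_bigr => i _; rewrite /= !rmorphM; ring.
Qed.

Lemma span0 : 0 \in span_pred.
Proof. by apply/span_predP; exists 0, (fun=> 0), (fun=> 0); rewrite big_ord0. Qed.

Lemma span_gen u v : f u * g v \in span_pred.
Proof. by apply/span_predP; exists 1%N, (fun=> u), (fun=> v); rewrite big_ord1. Qed.

Lemma span_subring : subring_closed span_pred.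
Proof.
split=> [|x y sx sy|x y /span_predP[n [a [b ->]]] sy].
- by rewrite -[1]mulr1 -{1}(rmorph1 f) -(rmorph1 g) span_gen.
- apply: span_add => //; rewrite -mulN1r -{1}[1]mulr1 -{1}(rmorph1 f) -(rmorph1 g) -mulNr -rmorphN.
  exact: span_mul1.
- rewrite big_distrl; elim/big_ind: _ => [||i _]; first exact: span0.
    exact: span_add.
  exact: span_mul1.
Qed.

Record span_ring := SpanRing { span_val :> C; _ : span_val \in span_pred }.

HB.instance Definition _ := [isSub for span_val].
HB.instance Definition _ := [Choice of span_ring by <:].
HB.instance Definition _ :=
  GRing.SubChoice_isSubComPzRing.Build C span_pred span_ring span_subring.

Definition span_val_mor : {rmorphism span_ring -> C} := (val : span_ring -> C).

Lemma spanl_in u : f u \in span_pred.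
Proof. by rewrite -[f u]mulr1 -(rmorph1 g) span_gen. Qed.

Lemma spanr_in v : g v \in span_pred.
Proof. by rewrite -[g v]mul1r -(rmorph1 f) span_gen. Qed.

Definition spanl u : span_ring := SpanRing (spanl_in u).
Definition spanr v : span_ring := SpanRing (spanr_in v).

Lemma spanl_zmod : zmod_morphism spanl.
Proof. by move=> u v; apply: val_inj; rewrite /= rmorphB. Qed.
Lemma spanl_monoid : monoid_morphism spanl.
Proof. by split=> [|u v]; apply: val_inj; rewrite /= ?rmorph1 ?rmorphM. Qed.
Lemma spanr_zmod : zmod_morphism spanr.
Proof. by move=> u v; apply: val_inj; rewrite /= rmorphB. Qed.
Lemma spanr_monoid : monoid_morphism spanr.
Proof. by split=> [|u v]; apply: val_inj; rewrite /= ?rmorph1 ?rmorphM. Qed.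

HB.instance Definition _ := GRing.isZmodMorphism.Build R1 span_ring spanl spanl_zmod.
HB.instance Definition _ := GRing.isMonoidMorphism.Build R1 span_ring spanl spanl_monoid.
HB.instance Definition _ := GRing.isZmodMorphism.Build R2 span_ring spanr spanr_zmod.
HB.instance Definition _ := GRing.isMonoidMorphism.Build R2 span_ring spanr spanr_monoid.

End SpanRing.

Section ProductBasis.
Variables (k : fieldType) (Y X P : scheme k) (p : morphism P Y) (q : morphism P X).
Hypothesis prodP : is_product p q.
Variables (U : set Y) (V : set X).
Hypotheses (chU : chart (@idfun (sect Y U) : {rmorphism _ -> _}))
  (chV : chart (@idfun (sect X V) : {rmorphism _ -> _})).
Let oU := chart_open chU.
Let oV := chart_open chV.

Definition rect : set P := p @^-1` U `&` q @^-1` V.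

Lemma open_rect : open rect.
Proof. by apply: openI; apply: open_preim. Qed.

Definition rect_fst : {rmorphism sect Y U -> sect P rect} :=
  GRing.RMorphism.clone _ _ (res (@subIsetl _ (p @^-1` U) (q @^-1` V)) \o pull p oU) _.
Definition rect_snd : {rmorphism sect X V -> sect P rect} :=
  GRing.RMorphism.clone _ _ (res (@subIsetr _ (p @^-1` U) (q @^-1` V)) \o pull q oV) _.

Let R := span_ring rect_fst rect_snd.
Let fst_R : {rmorphism sect Y U -> R} := spanl rect_fst rect_snd.
Let snd_R : {rmorphism sect X V -> R} := spanr rect_fst rect_snd.
Let val_R : {rmorphism R -> sect P rect} := span_val_mor rect_fst rect_snd.
Let cR : {rmorphism k -> R} := GRing.RMorphism.clone _ _ (fst_R \o cst Y U) _.

Let fst_cst x : exists2 b : sect Y U, b = cst Y U x & fst_R b = cR x.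
Proof. by exists (cst Y U x). Qed.

Let val_cst x : val_R (cR x) = cst P rect x.
Proof.
by rewrite /= pull_cst res_cst //; [apply: open_preim|apply: open_rect].
Qed.

(** [cR] is defined through [Y] only. The constants arriving through [X] agree with it, because both
    become the constants of [rect]. *)
Let snd_cst x : exists2 b : sect X V, b = cst X V x & snd_R b = cR x.
Proof.
exists (cst X V x) => //; apply: val_inj; rewrite -[RHS]/(val_R (cR x)) val_cst /=.
by rewrite pull_cst res_cst //; [apply: open_preim|apply: open_rect].
Qed.

(* [rect -> Spec R -> P] is the inclusion, by uniqueness in the universal
   property, tested on the spectra of the rings of small affine opens. *)
Lemma rect_retract : exists h : spec_scheme cR -> P, continuous h /\
  forall w, rect w -> exists2 x : spec_scheme cR, h x = w &
    forall r : R, ~ (x : spec R) r <-> germ_unit (val_R r) w.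
Proof.
pose mU := spec_mor chU fst_cst; pose mV := spec_mor chV snd_cst.
have [h [ph qh _]] := prodP mU mV.
exists h; split=> [|w Ww]; first exact: mfun_cont.
(* [rect] is not known to be affine, so the inclusion into [P] is tested on the spectrum of a small
   chart [D] around [w]; the map [psi] comes from restricting the elements of [R] to [D]. *)
have [D [chD Dw DW]] := chart_nbhd open_rect Ww.
have oD := chart_open chD.
pose resD : {rmorphism sect P rect -> sect P D} := res DW.
pose rho : {rmorphism R -> sect P D} := GRing.RMorphism.clone _ _ (resD \o val_R) _.
have idD x : exists2 b : sect P D, b = cst P D x & @idfun (sect P D) b = cst P D x.
  by exists (cst P D x).
pose i := spec_mor chD idD.
have rho_cst x : exists2 b : R, const_mor setT b = cst (spec_scheme cR) setT x & rho b = cst P D x.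
  exists (cR x) => //; rewrite -[LHS]/(res DW (val_R (cR x))) val_cst res_cst //.
  exact: open_rect.
pose psi := spec_mor (spec_chart cR) rho_cst.
have iD x : D (i x) by apply: spec_mor_dom.
have iW x : rect (i x) by apply: (DW).
have hp x : p (h x) = mU x by case: ph => + _; apply.
have hq x : q (h x) = mV x by case: qh => + _; apply.
have pull_psi (T : set (spec_scheme cR)) (oT : open T) (s : spec_sect T) a x :
    T (psi x) -> (forall y, T y -> s y a 1) -> 
    (pull psi oT (s : sect (spec_scheme cR) T) : spec_sect _) x (rho a) 1.
  move=> Tx sa; rewrite -(rmorph1 rho); apply: spec_mor_pull.
  apply: (representsW (spec_chart cR) (VU := @subsetT _ T)) => //.
  by rewrite (const_sect_germ sa); apply: restr_const.
have pull_i (T : set P) (oT : open T) (s : sect P T) (DT : D `<=` T) x :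
    (pull i oT s : spec_sect _) x (res DT s) 1.
  have repr : represents (@idfun (sect P D)) s (i x) (res DT s) 1.
    split; first exact: germ_unit1.
    exists D, DT, (@subset_refl _ D); split=> //.
    by rewrite !rmorph1 mulr1 res_id.
  exact: (spec_mor_pull oT repr).
(* Both composites pull a section [b] back to the restriction to [D] of its pullback by [p]. The
   other projection is treated in the same way, and uniqueness in the universal property then
   identifies [comp_mor h psi] with [i]. *)
have compU : eq_mor (comp_mor p (comp_mor h psi)) (comp_mor p i).
  apply: (mor_ext (ch := chU)) => [x|x|b W Wf Wg oW].
  - by rewrite /= hp; apply: spec_mor_dom.
  - by case: (iW x).
  - apply: spec_sect_ext => x Wx.
    have DpU : D `<=` p @^-1` U by move=> y /DW[].
    exists (rho (fst_R b)), 1, (res DpU (pull p oU b)), 1.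
    split; [|by apply: restr_sectE => //; apply: pull_i|].
      apply: restr_sectE => //; apply: pull_psi; first exact: Wf Wx.
      move=> y Uy; have [_ /(_ U setT oU openT)] := ph.
      have Sf : setT `<=` comp_mor p h @^-1` U by move=> z _; rewrite /= hp; apply: spec_mor_dom.
      have Sg : setT `<=` mU @^-1` U by move=> z _; apply: spec_mor_dom.
      move=> /(_ Sf Sg b) e.
      have : (res Sg (pull mU oU b) : spec_sect _) y (fst_R b) 1.
        apply: restr_sectE => //; rewrite -(rmorph1 fst_R); apply: spec_mor_pull.
        by apply: represents_const => //; apply: spec_mor_dom.
      by rewrite -e => -[].
    apply: same_frac_eq; congr (_ * _); rewrite -[LHS]/(res DW (res _ (pull p oU b))).
    by rewrite (res_res _ _ DpU) //; [apply: open_preim|apply: open_rect].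
have compV : eq_mor (comp_mor q (comp_mor h psi)) (comp_mor q i).
  apply: (mor_ext (ch := chV)) => [x|x|b W Wf Wg oW].
  - by rewrite /= hq; apply: spec_mor_dom.
  - by case: (iW x).
  - apply: spec_sect_ext => x Wx.
    have DqV : D `<=` q @^-1` V by move=> y /DW[].
    exists (rho (snd_R b)), 1, (res DqV (pull q oV b)), 1.
    split; [|by apply: restr_sectE => //; apply: pull_i|].
      apply: restr_sectE => //; apply: pull_psi; first exact: Wf Wx.
      move=> y Vy; have [_ /(_ V setT oV openT)] := qh.
      have Sf : setT `<=` comp_mor q h @^-1` V by move=> z _; rewrite /= hq; apply: spec_mor_dom.
      have Sg : setT `<=` mV @^-1` V by move=> z _; apply: spec_mor_dom.
      move=> /(_ Sf Sg b) e.
      have : (res Sg (pull mV oV b) : spec_sect _) y (snd_R b) 1.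
        apply: restr_sectE => //; rewrite -(rmorph1 snd_R); apply: spec_mor_pull.
        by apply: represents_const => //; apply: spec_mor_dom.
      by rewrite -e => -[].
    apply: same_frac_eq; congr (_ * _); rewrite -[LHS]/(res DW (res _ (pull q oV b))).
    by rewrite (res_res _ _ DqV) //; [apply: open_preim|apply: open_rect].
have [h0 [_ _ h0u]] := prodP (comp_mor p i) (comp_mor q i).
have refl (f : morphism (spec_scheme (cst P D)) Y) : eq_mor f f.
  by split=> // T W oT oW Wf Wg s; rewrite (Prop_irrelevance Wf Wg).
have refl' (f : morphism (spec_scheme (cst P D)) X) : eq_mor f f.
  by split=> // T W oT oW Wf Wg s; rewrite (Prop_irrelevance Wf Wg).
have [ih0 _] := h0u i (refl _) (refl' _).
have [psih0 _] := h0u _ compU compV.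
(* The point of the spectrum of [sect P D] lying over [w]; the required lift is its image by
   [psi]. *)
pose w' : spec_scheme (cst P D) := Spec (germ_unit_prime oD Dw).
have iw : i w' = w.
  by apply: spec_mor_eq => // b; rewrite /=; split=> [u|/contrapT//]; apply.
exists (psi w').
  by rewrite -[LHS]/(comp_mor h psi w') psih0 -ih0 iw.
move=> r; have := spec_morP (spec_chart cR) rho_cst w' r.
have /= -> := @germ_unit_const _ _ cR setT r (psi w') openT I => ->.
rewrite /= -(germ_unit_res DW _ open_rect oD Dw).
by split=> [/contrapT|u]; [|apply].
Qed.

(** The preimage of [O] under the continuous map [h] contains a basic open around a lift of [z]. It
    is given by an element of [R], which is a finite sum of products. *)
Lemma product_basis (O : set P) z : open O -> O z -> rect z ->
  exists n (a : 'I_n -> sect Y U) (b : 'I_n -> sect X V),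
    let r := \sum_i rect_fst (a i) * rect_snd (b i) in
    germ_unit r z /\ forall w, rect w -> germ_unit r w -> O w.
Proof.
move=> oO Oz Wz; have [h [/continuousP hc hr]] := rect_retract.
have [x hx xu] := hr z Wz.
have ohO : spec_open (h @^-1` O) by apply: hc.
have [|r xr rO] := ohO x; first by rewrite /= hx.
have /span_predP[n [a [b rE]]] := valP r.
exists n, a, b; rewrite /= -rE; split; first exact/xu.
move=> w Ww rw; have [y hy yu] := hr w Ww.
by rewrite -hy; apply: rO; apply/yu.
Qed.

End ProductBasis.

(** * The Nullstellensatz *)

Lemma expr_subnK (R : pzSemiRingType) (x : R) m n : (m <= n)%N ->
  x ^+ n = x ^+ (n - m) * x ^+ m.
Proof. by move=> le; rewrite -exprD subnK. Qed.

Section Integral.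
Variables (R : comNzRingType) (K : fieldType) (f : {rmorphism R -> K}).

Lemma integralX u n : integralOver f u -> integralOver f (u ^+ n).
Proof.
move=> iu; elim: n => [|n IH]; first by rewrite expr0; apply: integral1.
by rewrite exprS; apply: integral_mul.
Qed.

Lemma integral_sum (I : finType) (F : I -> K) :
  (forall i, integralOver f (F i)) -> integralOver f (\sum_i F i).
Proof.
move=> iF; elim/big_ind: _ => [|u v iu iv|i _]; [exact: integral0| |exact: iF].
exact: integral_add.
Qed.

(** With [d] the leading coefficient and [n] the degree, multiplying [p.[u]] by [d ^+ n.-1] gives
    the value at [d * u] of a monic polynomial with coefficients [p_i * d ^+ (n.-1 - i)]. A constant
    [p] would be zero. *)
Lemma integral_lead_mul (p : {poly K}) u : root p u -> p != 0 ->
  (forall i, integralOver f p`_i) -> integralOver f (lead_coef p * u).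
Proof.
move=> /rootP pu p0 ip; set d := lead_coef p.
case: (posnP (size p).-1) => [n0|n_gt0].
  have pC : p = d%:P.
    rewrite /d /lead_coef n0; apply/size1_polyC.
    by rewrite -ltnS (leq_ltn_trans (leqSpred _)) // n0.
  by move: pu p0; rewrite pC hornerC => ->; rewrite polyC0 eqxx.
pose n := (size p).-1; rewrite -/n in n_gt0.
pose q := \poly_(i < n.+1) (if i == n then 1 else p`_i * d ^+ (n.-1 - i)).
have qn : q`_n = 1 by rewrite coef_poly ltnSn eqxx.
have sq : size q = n.+1.
  apply/eqP; rewrite eqn_leq size_poly /= ltnNge; apply/negP => /leq_sizeP/(_ n (leqnn n)).
  by rewrite qn => /eqP; rewrite oner_eq0.
apply: (@integral_root_monic _ _ f _ q).
- by rewrite monicE /lead_coef sq qn.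
- apply/rootP; rewrite (horner_coef_wide _ (eq_leq sq)).
  transitivity (d ^+ n.-1 * p.[u]); last by rewrite pu mulr0.
  rewrite horner_coef -(prednK (n := size p)) ?size_poly_gt0 // -/n big_distrr /=.
  have dn : d ^+ n = d ^+ n.-1 * d by rewrite -exprSr prednK.
  apply: eq_bigr => i _; rewrite coef_poly ltn_ord exprMn.
  case: eqP => [->|/eqP ni]; first by rewrite mul1r -[p`_n]/d dn; ring.
  have le : (i <= n.-1)%N by rewrite -ltnS prednK // ltn_neqAle ni leq_ord.
  by rewrite (expr_subnK d le); ring.
- apply/integral_poly => i; rewrite coef_poly; case: ifP => _; last exact: integral0.
  case: ifP => _; first exact: integral1.
  by apply: integral_mul => //; apply: integralX; apply: ip.
Qed.

(** The reversal of an integral equation of [u] has the root [u^-1]. Its leading coefficient is the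
    lowest coefficient of the equation that survives in [K]; this is [f e]. *)
Lemma integral_inv_mul u : u != 0 -> integralOver f u ->
  exists2 e, f e != 0 & integralOver f (f e / u).
Proof.
move=> u0 [p mp /rootP pu]; pose n := (size p).-1.
have sp : size p = n.+1 by rewrite prednK // size_poly_gt0 monic_neq0.
pose q := \poly_(i < n.+1) (map_poly f p)`_(n - i).
have q0 : q != 0.
  apply/eqP => /(congr1 (fun q : {poly K} => q`_0)).
  rewrite coef_poly /= subn0 coef0 coef_map /= -[p`_n]/(lead_coef p) (monicP mp) rmorph1.
  by move/eqP; rewrite oner_eq0.
have qf i : exists a, q`_i = f a.
  by rewrite coef_poly; case: ifP => _; [rewrite coef_map; eexists|exists 0; rewrite rmorph0].
have [e eE] := qf (size q).-1.
have leadE : lead_coef q = f e by rewrite lead_coefE.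
exists e; first by rewrite -leadE lead_coef_eq0.
rewrite -leadE; apply: integral_lead_mul => //.
  apply/rootP; rewrite (horner_coef_wide _ (size_poly _ _)).
  transitivity (u ^- n * (map_poly f p).[u]); last by rewrite pu mulr0.
  have spf : (size (map_poly f p) <= n.+1)%N by rewrite -sp size_poly.
  rewrite (horner_coef_wide _ spf) (reindex_inj rev_ord_inj) /= big_distrr.
  apply: eq_bigr => i _ /=; rewrite subSS.
  have le : (i <= n)%N by rewrite -ltnS.
  rewrite coef_poly ltnS leq_subr subKn // exprVn.
  rewrite mulrCA; congr (_ * _); rewrite (expr_subnK u le) invfM.
  by rewrite -mulrA mulVf ?mulr1 // expf_neq0.
by move=> i; have [a ->] := qf i; apply: integral_id.
Qed.

End Integral.

(* [K] is integral over the localization of [R] at [s].  In the induction step a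
   transcendental generator would make [1 + 'X * s] divide a power of [s]. *)
Lemma zariski_integral n : forall (R : comNzRingType) (K : fieldType)
    (f : {rmorphism R -> K}) (g : 'I_n -> K),
  (forall S : set K, (forall a, S (f a)) -> (forall i, S (g i)) ->
     (forall a b, S a -> S b -> S (a + b)) ->
     (forall a b, S a -> S b -> S (a * b)) -> forall a, S a) ->
  exists2 s, f s != 0 & forall y, exists N, integralOver f (f s ^+ N * y).
Proof.
elim: n => [|n IH] R K f g gen.
  exists 1 => [|y]; first by rewrite rmorph1 oner_eq0.
  exists 0; rewrite mul1r; move: y.
  apply: (gen [set y | integralOver f y]) => [a|[]//|a b|a b] /=.
  - exact: integral_id.
  - exact: integral_add.
  - exact: integral_mul.
pose x := g ord0.
(* The first generator moves into the base ring: [K] is generated over [{poly R}] by the remaining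
   ones. *)
pose ev : {rmorphism {poly R} -> K} := horner_morph (fun a => mulrC x (f a)).
have evE p : ev p = (map_poly f p).[x] by [].
have [S SR Sg SD SM|s s0 sint] := IH {poly R} K ev (fun i => g (lift ord0 i)).
  apply: gen => // [a|i]; first by have := SR a%:P; rewrite evE map_polyC hornerC.
  case: (unliftP ord0 i) => [j ->|->]; first exact: Sg.
  by have := SR 'X; rewrite evE map_polyX hornerX.
have [[Q [Q0 evQ]]|trans] :=
    pselect (exists Q : {poly R}, map_poly f Q != 0 /\ ev Q = 0).
  pose d := lead_coef (map_poly f Q).
  have [e eE] : exists e, d = f e by rewrite /d lead_coefE coef_map; eexists.
  have d0 : d != 0 by rewrite lead_coef_eq0.
  have id : integralOver f d by rewrite eE; apply: integral_id.
  have idx : integralOver f (d * x).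
    apply: integral_lead_mul => //; first by apply/rootP.
    by move=> i; rewrite coef_map; apply: integral_id.
  have iev (c : {poly R}) M : (size c <= M)%N -> integralOver f (d ^+ M * ev c).
    move=> sM; have sfM : (size (map_poly f c) <= M)%N by rewrite (leq_trans (size_poly _ _)).
    rewrite evE (horner_coef_wide _ sfM) big_distrr /=; apply: integral_sum => i.
    rewrite (expr_subnK d (ltnW (ltn_ord i))) coef_map /=.
    rewrite (_ : _ * _ = d ^+ (M - i) * f c`_i * (d * x) ^+ i); last by rewrite exprMn; ring.
    apply: integral_mul; last exact: integralX.
    by apply: integral_mul; [apply: integralX|apply: integral_id].
  have idy y : exists N M, integralOver f (d ^+ M * (ev s ^+ N * y)).
    have [N [P mP rP]] := sint y; exists N; set u := ev s ^+ N * y in rP *.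
    (* [M] bounds the sizes of the coefficients of [P], which are polynomials evaluated at [x];
       multiplication by [d ^+ M] therefore makes all of them integral over [R]. *)
    pose M := \max_(i < size P) size (P`_i)%R; exists M.
    have dM0 : d ^+ M != 0 by apply: expf_neq0.
    have <- : lead_coef (d ^+ M *: map_poly ev P) = d ^+ M.
      by rewrite lead_coefZ (monicP (monic_map ev mP)) mulr1.
    apply: integral_lead_mul.
    - by rewrite rootZ.
    - by rewrite scaler_eq0 negb_or dM0 monic_neq0 ?monic_map.
    - move=> i; rewrite coefZ coef_map /=; apply: iev.
      have [iP|iP] := ltnP i (size P).
        exact: (leq_bigmax (F := fun i : 'I__ => size (P`_i)%R) (Ordinal iP)).
      by rewrite nth_default // size_poly0.
  (* The induction hypothesis inverts [ev s], which need not come from [R]. As a multiple of it is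
     integral, its inverse can be traded for that of some [f e0]. *)
  have [M0 itau] : exists M, integralOver f (d ^+ M * ev s) by exists (size s); apply: iev.
  have tau0 : d ^+ M0 * ev s != 0 by rewrite mulf_neq0 // expf_neq0.
  have [e0 e00 ie0] := integral_inv_mul tau0 itau.
  exists (e * e0); first by rewrite rmorphM mulf_neq0 // -eE.
  move=> y; have [N [M iy]] := idy y; exists (M + N)%N.
  rewrite rmorphM -eE exprMn.
  have -> : d ^+ (M + N) * f e0 ^+ (M + N) * y =
      (d ^+ N * f e0 ^+ M * d ^+ (M0 * N)) * ((d ^+ M * (ev s ^+ N * y)) *
        (f e0 / (d ^+ M0 * ev s)) ^+ N).
    rewrite expr_div_n exprMn -exprM !exprD.
    by field; rewrite ?expf_neq0.
  have ie : integralOver f (f e0) by apply: integral_id.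
  apply: integral_mul; last by apply: integral_mul => //; apply: integralX.
  by do ?apply: integral_mul; apply: integralX.
have inj Q : ev Q = 0 -> map_poly f Q = 0.
  by move=> evQ; apply: contrapT => /eqP Q0; apply: trans; exists Q.
pose p := 1 + 'X * s.
have fp : map_poly f p = 1 + 'X * map_poly f s by rewrite rmorphD rmorph1 rmorphM /= map_polyX.
have p0 : ev p != 0.
  apply/eqP => /inj/(congr1 (fun q : {poly K} => q`_0)); rewrite fp.
  rewrite coefD coefXM coef1 coef0 /= addr0 => /eqP; by rewrite oner_eq0.
have [N [P mP /rootP rP]] := sint (ev p)^-1.
pose m := (size P).-1.
have sP : size P = m.+1 by rewrite prednK // size_poly_gt0 monic_neq0.
(* The lower terms of the integral equation of [ev s ^+ N / ev p], multiplied by [ev p ^+ m], with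
   one factor [p] taken out. The leading term becomes [s ^+ (N * m)], so over [K] the polynomial [p]
   divides a power of [s], although it is prime to [s] and not constant. *)
pose c := \sum_(i < m) P`_i * s ^+ (N * i) * p ^+ (m.-1 - i).
have evc : ev (s ^+ (N * m) + p * c) = 0.
  transitivity (ev p ^+ m * (map_poly ev P).[ev s ^+ N / ev p]); last by rewrite rP mulr0.
  have sPe : (size (map_poly ev P) <= m.+1)%N by rewrite -sP size_poly.
  rewrite (horner_coef_wide _ sPe) big_ord_recr /= coef_map /= -[P`_m]/(lead_coef P).
  rewrite (monicP mP) rmorph1 mul1r mulrDr addrC rmorphD; congr (_ + _).
    rewrite rmorphM rmorph_sum big_distrr big_distrr /=; apply: eq_bigr => i _.
    rewrite coef_map !rmorphM !rmorphXn /= expr_div_n exprM.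
    have im : (i <= m.-1)%N by rewrite -ltnS prednK // (leq_ltn_trans _ (ltn_ord i)).
    have -> : ev p ^+ m = ev p * ev p ^+ (m.-1 - i) * ev p ^+ i.
      by rewrite -mulrA -exprD subnK // -exprS prednK // (leq_ltn_trans _ (ltn_ord i)).
    by field; rewrite ?expf_neq0.
  by rewrite rmorphXn /= expr_div_n -exprM; field; rewrite expf_neq0.
have dv : map_poly f p %| map_poly f s ^+ (N * m).
  move/inj: evc; rewrite rmorphD rmorphM rmorphXn /= => /eqP; rewrite addr_eq0 => /eqP ->.
  by rewrite dvdpNr dvdp_mulr.
have fs0 : map_poly f s != 0 by apply: contraNneq s0 => e; rewrite evE e horner0.
have sz : (1 < size (map_poly f p))%N.
  have sX : (1 < size ('X * map_poly f s)%R)%N by rewrite mulrC size_mulX // ltnS size_poly_gt0.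
  by rewrite fp addrC size_polyDl ?size_poly1.
have cop : coprimep (map_poly f p) (map_poly f s).
  rewrite coprimep_sym fp addrC; apply/Bezout_eq1_coprimepP.
  by exists (- 'X, 1) => /=; ring.
have := coprimep_dvdl dv (coprimep_expr (N * m) cop).
by rewrite coprimepp => /eqP e; rewrite e in sz.
Qed.

(** Over a field, the localized element is already invertible, so [y] is integral over [k]; its
    monic equation splits into linear factors with roots in [k]. *)
Lemma zariski_closed (k : closedFieldType) (K : fieldType) (f : {rmorphism k -> K})
    n (g : 'I_n -> K) :
  (forall S : set K, (forall a, S (f a)) -> (forall i, S (g i)) ->
     (forall a b, S a -> S b -> S (a + b)) ->
     (forall a b, S a -> S b -> S (a * b)) -> forall a, S a) ->
  forall y, exists a, y = f a.
Proof.
move=> gen y; have [s s0 sint] := zariski_integral gen.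
have [N iN] := sint y.
have [P mP rP] : integralOver f y.
  rewrite -(mulKf (expf_neq0 N s0) y); apply: integral_mul => //.
  by rewrite -rmorphXn -fmorphV; apply: integral_id.
have [r Pr] := closed_field_poly_normal P; move: rP.
rewrite Pr (monicP mP) scale1r rmorph_prod /root horner_prod prodf_seq_eq0 => /hasP[a _ /=].
by rewrite map_polyXsubC hornerXsubC subr_eq0 => /eqP; exists a.
Qed.

(** * The residue field of a maximal ideal *)

Section Residue.
Variables (A : comPzRingType) (m : set A).
Hypotheses (mp : prime_ideal m) (m_max : forall a, ~ m a -> exists b, m (a * b - 1)).

Lemma prime_idealN a : m a -> m (- a).
Proof. by rewrite -mulN1r; apply: prime_ideal_mull. Qed.

Lemma prime_idealD a b : m a -> m b -> m (a + b).
Proof. by case: mp => _ mD _ _ _; apply: mD. Qed.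

(** One element chosen in each class modulo [m]. The residue field is realized as the subtype of
    chosen elements; the default 0 is never reached, since [a] lies in its own class. *)
Definition representative (a : A) : A := xget 0 [set b | m (a - b)].

Lemma representativeP a : m (a - representative a).
Proof.
by apply: (@xgetPex _ 0 [set b | m (a - b)]); exists a; rewrite /= subrr; case: mp.
Qed.

Lemma representative_eq a b : m (a - b) -> representative a = representative b.
Proof.
move=> mab; congr xget; apply/seteqP; split=> x /= mx.
  by rewrite (_ : b - x = - (a - b) + (a - x)); [apply: prime_idealD|ring] => //; apply: prime_idealN.
by rewrite (_ : a - x = (a - b) + (b - x)); [apply: prime_idealD|ring].
Qed.

Lemma representative_idem a : representative (representative a) == representative a.
Proof.
apply/eqP/representative_eq; rewrite -opprB; apply: prime_idealN.
exact: representativeP.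
Qed.

Record residue := Residue { residue_rep : A; _ : representative residue_rep == residue_rep }.

HB.instance Definition _ := [isSub for residue_rep].
HB.instance Definition _ := [Choice of residue by <:].

Definition to_residue (a : A) : residue := Residue (representative_idem a).

Lemma residue_repK x : to_residue (residue_rep x) = x.
Proof. by apply: val_inj; case: x => x /= /eqP. Qed.

Lemma to_residue_eq a b : to_residue a = to_residue b <-> m (a - b).
Proof.
split=> [/(congr1 residue_rep) /= e|mab].
  rewrite (_ : a - b = (a - representative a) + - (b - representative b)).
    by apply: prime_idealD; [|apply: prime_idealN]; apply: representativeP.
  by rewrite e; ring.
by apply: val_inj; apply: representative_eq.
Qed.

Lemma residue_ind (Q : residue -> Prop) : (forall a, Q (to_residue a)) -> forall x, Q x.
Proof. by move=> Qt x; rewrite -[x]residue_repK. Qed.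

Definition residue_add x y := to_residue (residue_rep x + residue_rep y).
Definition residue_mul x y := to_residue (residue_rep x * residue_rep y).
Definition residue_opp x := to_residue (- residue_rep x).

Lemma residue_addE a b : residue_add (to_residue a) (to_residue b) = to_residue (a + b).
Proof.
apply/to_residue_eq => /=.
rewrite (_ : _ - _ = - (a - representative a) + - (b - representative b)); last by ring.
by apply: prime_idealD; apply: prime_idealN; apply: representativeP.
Qed.

Lemma residue_mulE a b : residue_mul (to_residue a) (to_residue b) = to_residue (a * b).
Proof.
apply/to_residue_eq => /=.
rewrite (_ : _ - _ = - ((a - representative a) * representative b) +
  - (a * (b - representative b))); last by ring.
apply: prime_idealD; apply: prime_idealN.
  by apply: prime_ideal_mulr => //; apply: representativeP.
by apply: prime_ideal_mull => //; apply: representativeP.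
Qed.

Lemma residue_oppE a : residue_opp (to_residue a) = to_residue (- a).
Proof.
apply/to_residue_eq => /=; rewrite (_ : _ - _ = a - representative a); last by ring.
exact: representativeP.
Qed.

Lemma residue_addA : associative residue_add.
Proof.
elim/residue_ind=> a; elim/residue_ind=> b; elim/residue_ind=> c.
by rewrite !residue_addE addrA.
Qed.

Lemma residue_addC : commutative residue_add.
Proof. by elim/residue_ind=> a; elim/residue_ind=> b; rewrite !residue_addE addrC. Qed.

Lemma residue_add0 : left_id (to_residue 0) residue_add.
Proof. by elim/residue_ind=> a; rewrite residue_addE add0r. Qed.

Lemma residue_addN : left_inverse (to_residue 0) residue_opp residue_add.
Proof. by elim/residue_ind=> a; rewrite residue_oppE residue_addE addNr. Qed.

Lemma residue_mulA : associative residue_mul.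
Proof.
elim/residue_ind=> a; elim/residue_ind=> b; elim/residue_ind=> c.
by rewrite !residue_mulE mulrA.
Qed.

Lemma residue_mulC : commutative residue_mul.
Proof. by elim/residue_ind=> a; elim/residue_ind=> b; rewrite !residue_mulE mulrC. Qed.

Lemma residue_mul1 : left_id (to_residue 1) residue_mul.
Proof. by elim/residue_ind=> a; rewrite residue_mulE mul1r. Qed.

Lemma residue_mulD : left_distributive residue_mul residue_add.
Proof.
elim/residue_ind=> a; elim/residue_ind=> b; elim/residue_ind=> c.
by rewrite !(residue_mulE, residue_addE) mulrDl.
Qed.

Lemma residue_1neq0 : to_residue 1 != to_residue 0.
Proof.
by apply/eqP => /to_residue_eq; rewrite subr0; apply: prime_idealN1.
Qed.

HB.instance Definition _ := GRing.isZmodule.Build residue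
  residue_addA residue_addC residue_add0 residue_addN.
HB.instance Definition _ := GRing.Zmodule_isComNzRing.Build residue
  residue_mulA residue_mulC residue_mul1 residue_mulD residue_1neq0.

Lemma residue_inv_ex (x : residue) : exists y : residue, x != 0 -> y * x = 1.
Proof.
elim/residue_ind: x => a; have [ma|/m_max[b mb]] := pselect (m a).
  exists 0 => /negP[]; apply/eqP/to_residue_eq; by rewrite subr0.
exists (to_residue b) => _; rewrite [LHS]residue_mulE; apply/to_residue_eq.
by rewrite mulrC.
Qed.

Definition residue_inv (x : residue) : residue :=
  if x == 0 then 0 else sval (cid (residue_inv_ex x)).

Lemma residue_mulV (x : residue) : x != 0 -> residue_inv x * x = 1.
Proof. by move=> x0; rewrite /residue_inv ifN //; apply: (svalP (cid (residue_inv_ex x))). Qed.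

Lemma residue_inv0 : residue_inv 0 = 0.
Proof. by rewrite /residue_inv ifT. Qed.

HB.instance Definition _ := GRing.ComNzRing_isField.Build residue residue_mulV residue_inv0.

Lemma to_residueB : zmod_morphism to_residue.
Proof. by move=> a b; rewrite -residue_addE -residue_oppE. Qed.

Lemma to_residueM : monoid_morphism to_residue.
Proof. by split=> // a b; rewrite -residue_mulE. Qed.

HB.instance Definition _ := GRing.isZmodMorphism.Build A residue to_residue to_residueB.
HB.instance Definition _ := GRing.isMonoidMorphism.Build A residue to_residue to_residueM.

(** Generators of [A] give generators of the residue field as a [k]-algebra, to which
    [zariski_closed] applies. *)
Lemma nullstellensatz (k : closedFieldType) (c : {rmorphism k -> A}) :
  fg_algebra c -> forall a, exists x, m (a - c x).
Proof.
move=> [n [g gen]] a.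
pose f : {rmorphism k -> residue} :=
  GRing.RMorphism.clone _ _ ((to_residue : {rmorphism A -> residue}) \o c) _.
have [S Sc Sg SD SM|x ax] := @zariski_closed k residue f n (to_residue \o g) _ (to_residue a).
  elim/residue_ind; apply: (gen (to_residue @^-1` S)) => // [u v Su Sv|u v Su Sv].
    by rewrite /= -residue_addE; apply: SD.
  by rewrite /= -residue_mulE; apply: SM.
by exists x; apply/to_residue_eq.
Qed.

End Residue.

(** * Integral schemes and values at a closed point *)

Section Integrality.
Variables (k : fieldType) (X : scheme k).
Hypothesis intX : integral X.

(** On a chart, such a section lies in every prime, so it is nilpotent, and the ring of sections is
    a domain. Charts cover [U]. *)
Lemma nowhere_unit_eq0 (U : set X) (s : sect X U) : open U ->
  (forall x, U x -> ~ germ_unit s x) -> s = 0.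
Proof.
move=> oU su.
have [|D DP] := @choice {x | U x} (set X) (fun i D =>
    [/\ chart (@idfun (sect X D) : {rmorphism _ -> _}), D (sval i) & D `<=` U]).
  by case=> x Ux; apply: chart_nbhd.
have DU i : D i `<=` U by case: (DP i).
have oD i : open (D i) by case: (DP i) => /chart_open.
apply: (sheaf_sep (V := D) (VU := DU)) => // [x Ux|i].
  by exists (exist _ x Ux) => //; case: (DP (exist _ x Ux)).
case: (DP i) => chD Dx _; rewrite rmorph0.
have [_ /(_ (D i) (oD i) (ex_intro _ _ Dx))[_ dom]] := intX.
have [|p pp _|n] := @prime_nilpotent _ [set 0] (res (DU i) s).
- split=> //; first by move=> a b -> ->; rewrite addr0.
  by move=> a b ->; rewrite mulr0.
- have [y Dy ->] := chart_point chD pp; rewrite germ_unit_res //.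
  by apply: su; apply: DU Dy.
- elim: n => [|n IH] /=.
    by rewrite expr0 => e; rewrite -[LHS]mul1r e mul0r.
  by rewrite exprS => /dom[].
Qed.

Lemma empty_sect_eq (U : set X) (s t : sect X U) : (forall x, ~ U x) -> s = t.
Proof.
move=> U0; have oU : open U.
  by rewrite (_ : U = set0); [exact: open0|apply/seteqP; split=> x // /U0].
by apply: (sheaf_sep (V := fun v : False => match v with end)
  (VU := fun v => match v with end)) => // x /U0.
Qed.

(** If [U] and [V] were disjoint, 1 on [U] and 0 on [V] would glue to a section [e] of the union
    with [e * (1 - e) = 0] and neither factor zero. *)
Lemma integral_irreducible (U V : set X) : open U -> open V ->
  U !=set0 -> V !=set0 -> U `&` V !=set0.
Proof.
move=> oU oV [x Ux] [y Vy]; apply: contrapT => UV0.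
have {}UV0 z : ~ (U `&` V) z by move=> UVz; apply: UV0; exists z.
have oW := openU oU oV; set W := U `|` V in oW.
pose C (b : bool) := if b then U else V.
have CW b : C b `<=` W by case: b => z; [left|right].
have oC b : open (C b) by case: b.
pose s b : sect X (C b) := if b then 1 else 0.
have cov : W `<=` \bigcup_b C b by move=> z [Uz|Vz]; [exists true|exists false].
have [|e eE] := sheaf_glue CW (s := s) oW oC cov.
  move=> b b'; case: (eqVneq b b') => [<- Wi Wj|nb Wi Wj].
    by rewrite (Prop_irrelevance Wi Wj).
  apply: empty_sect_eq => z; case: b b' nb {Wi Wj} => -[] // _ [] *; exact: (UV0 z).
have eU := eE true; have eV := eE false; rewrite /s in eU eV.
have [_ /(_ W oW)[|_ /(_ e (1 - e))]] := intX; first by exists x; left.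
case.
- apply: (sheaf_sep (V := C) (VU := CW)) => // b.
  rewrite rmorphM rmorphB rmorph1 rmorph0 eE /s; case: b; first by rewrite subrr mulr0.
  by rewrite mul0r.
- move=> e0; have [_ /(_ U oU (ex_intro _ _ Ux))[U1 _]] := intX; apply: U1.
  by rewrite -eU e0 rmorph0.
- move=> /eqP; rewrite subr_eq0 => /eqP e1.
  have [_ /(_ V oV (ex_intro _ _ Vy))[V1 _]] := intX; apply: V1.
  by rewrite -eV -e1 rmorph1.
Qed.

(** A nonzero section is a unit on a nonempty open set, which meets [V] by irreducibility. *)
Lemma res_inj (U V : set X) (VU : V `<=` U) (s : sect X U) : open U -> open V ->
  V !=set0 -> res VU s = 0 -> s = 0.
Proof.
move=> oU oV V0 s0; apply: nowhere_unit_eq0 => // x Ux sx.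
have [|y [sy Vy]] := integral_irreducible (open_basic_open s oU) oV _ V0.
  by exists x.
by apply: (germ_unit0 (x := y) oV); rewrite -s0; apply/germ_unit_res.
Qed.

End Integrality.

Section Evaluation.
Variables (k : closedFieldType) (Y : scheme k).
Hypothesis ftY : finite_type Y.
Variable y0 : Y.
Hypothesis closed_y0 : closed [set y0].

Section Value.
Variables (N : set Y) (oN : open N) (Ny0 : N y0).

(** On an affine neighbourhood with finitely generated sections, the sections that are not units at
    [y0] form a maximal ideal because [y0] is closed, and the Nullstellensatz applies. Near [y0], a
    section on [N] is a fraction of such sections. *)
Lemma value_ex (s : sect Y N) : exists x : k, ~ germ_unit (s - cst Y N x) y0.
Proof.
have [n [U0 [affU fgU /(_ y0)[i Uy0]]]] := ftY.
move: (U0 i) (affU i) (fgU i) Uy0 => U {affU fgU} affU fgU Uy0.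
have [oU Upt _ Ubasis Uloc] := affU.
pose m := [set t : sect Y U | ~ germ_unit t y0].
have mp : prime_ideal m by apply: germ_unit_prime.
(* If [m] and [a] do not generate the unit ideal, they lie in a prime, that is in a point [y] of
   [U]. A point other than [y0] would have a basic neighbourhood missing [y0], given by an element
   of [m] that is a unit at [y]. *)
have m_max a : ~ m a -> exists b, m (a * b - 1).
  move=> ma; have iI := is_ideal_addl a (prime_idealP mp); set I := [set x | _] in iI.
  have mI : m `<=` I by move=> t mt; exists t => //; exists 0; rewrite mul0r addr0.
  have [I1|nI1] := pselect (I 1).
    have [u mu [v e]] := I1; exists v; rewrite e (_ : _ - _ = - u); last by ring.
    exact: (prime_idealN mp).
  have [|p pp [Ip _]] := @prime_avoid _ I 1 iI; first by move=> j; rewrite expr1n.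
  have [y Uy pE] := Upt p pp; exfalso.
  have yy0 : y = y0.
    apply: contrapT => nyy0.
    have oW : open (U `&` ~` [set y0]) by apply: openI => //; apply: closed_openC.
    have [f [fy fW]] := Ubasis _ y oW (@subIsetl _ _ _) (conj Uy nyy0).
    have /mI/Ip : m f by move=> /fW[_]; apply.
    by rewrite pE.
  have /Ip : I a by exists 0; [exact: germ_unit0|exists 1; ring].
  by rewrite pE yy0 => /ma.
have null := nullstellensatz mp m_max fgU.
have oNU := openI oN oU.
have [f [fy fN]] := Ubasis _ y0 oNU (@subIsetr _ N U) (conj Ny0 Uy0).
have fN' : basic_open f `<=` N by move=> y /fN[].
have of_ := open_basic_open f oU.
have [_ /(_ (res fN' s))[j [b bE]]] := Uloc f.
(* Values of the numerator and of the denominator of [s]; the value of [s] is their quotient. *)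
have [be mbe] := null b; have [de mde] := null (f ^+ j).
have uf : germ_unit (f ^+ j) y0 by apply: germ_unitX.
have de0 : de != 0.
  by apply/eqP => de0; move: mde; rewrite de0 rmorph0 subr0; apply.
exists (be / de) => us.
have : m (b - f ^+ j * cst Y U (be / de)).
  rewrite (_ : _ - _ = (b - cst Y U be) + - ((f ^+ j - cst Y U de) * cst Y U (be / de))).
    apply: (prime_idealD mp) => //; apply: (prime_idealN mp).
    exact: prime_ideal_mulr mp mde.
  by rewrite mulrBl -rmorphM mulrCA divff // mulr1; ring.
apply; apply/(germ_unit_res (@basic_open_sub _ _ _ f)) => //.
rewrite rmorphB rmorphM bE res_cst //.
have -> : cst Y (basic_open f) (be / de) = res fN' (cst Y N (be / de)) by rewrite res_cst.
rewrite -mulrBr -rmorphB; apply/germ_unitM => //.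
by split; apply/germ_unit_res.
Qed.

Lemma value_unique (s : sect Y N) x x' :
  ~ germ_unit (s - cst Y N x) y0 -> ~ germ_unit (s - cst Y N x') y0 -> x = x'.
Proof.
move=> nx nx'; have mp := germ_unit_prime oN Ny0; apply: contrapT => /eqP.
rewrite eq_sym -subr_eq0 => xx'.
have : germ_unit (cst Y N (x' - x)) y0.
  apply: (germ_unit_inv (t := cst Y N (x' - x)^-1)) => //.
  by rewrite -rmorphM divff ?rmorph1.
suff : ~ germ_unit (cst Y N (x' - x)) y0 by [].
rewrite rmorphB (_ : _ - _ = (s - cst Y N x) + - (s - cst Y N x')); last by ring.
by apply: (prime_idealD mp) => //; apply: (prime_idealN mp).
Qed.

Definition value (s : sect Y N) : k := sval (cid (value_ex s)).

Lemma valueP s : ~ germ_unit (s - cst Y N (value s)) y0.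
Proof. exact: svalP (cid (value_ex s)). Qed.

Lemma value_eq s x : ~ germ_unit (s - cst Y N x) y0 -> value s = x.
Proof. by apply: value_unique; apply: valueP. Qed.

Lemma value_zmod : zmod_morphism value.
Proof.
move=> s t; apply: value_eq; have mp := germ_unit_prime oN Ny0.
rewrite rmorphB (_ : _ - _ = (s - cst Y N (value s)) + - (t - cst Y N (value t))); last by ring.
by apply: (prime_idealD mp) => //; [|apply: (prime_idealN mp)]; apply: valueP.
Qed.

Lemma value_monoid : monoid_morphism value.
Proof.
have mp := germ_unit_prime oN Ny0; split=> [|s t]; apply: value_eq.
  by rewrite rmorph1 subrr; case: mp.
rewrite rmorphM (_ : _ - _ = t * (s - cst Y N (value s)) +
  cst Y N (value s) * (t - cst Y N (value t))); last by ring.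
by apply: (prime_idealD mp); apply: (prime_ideal_mull _ mp); apply: valueP.
Qed.

HB.instance Definition _ := GRing.isZmodMorphism.Build (sect Y N) k value value_zmod.
HB.instance Definition _ := GRing.isMonoidMorphism.Build (sect Y N) k value value_monoid.

Definition eval : {rmorphism sect Y N -> k} := value.

Lemma eval_cst x : eval (cst Y N x) = x.
Proof. by apply: value_eq; rewrite subrr; have [] := germ_unit_prime oN Ny0. Qed.

Lemma eval_eq0 s : eval s = 0 <-> ~ germ_unit s y0.
Proof.
split=> [s0|us]; first by have := @valueP s; rewrite -[value s]/(eval s) s0 rmorph0 subr0.
by apply: value_eq; rewrite rmorph0 subr0.
Qed.

End Value.

Lemma eval_res (N M : set Y) (oN : open N) (Ny0 : N y0) (oM : open M) (My0 : M y0)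
  (MN : M `<=` N) (s : sect Y N) : eval oM My0 (res MN s) = eval oN Ny0 s.
Proof.
apply: value_eq => u; apply: (@valueP N oN Ny0 s).
by apply/(germ_unit_res MN) => //; rewrite rmorphB res_cst.
Qed.

End Evaluation.

(** Independent rows are collected one at a time. Fewer than [n] of them have a common nonzero
    kernel vector; if not all [v j] kill it, one that does not is independent of the rows already
    found. *)
Lemma kernel_or_minor (F : fieldType) (J : Type) (n : nat) (v : J -> 'rV[F]_n) :
  (exists2 w : 'cV[F]_n, w != 0 & forall j, v j *m w = 0) \/
  exists l : 'I_n -> J, \det (\matrix_(i < n) v (l i)) != 0.
Proof.
have [|nex] := pselect (exists2 w : 'cV[F]_n, w != 0 & forall j, v j *m w = 0).
  by left.
right; suff free r : (r <= n)%N ->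
    exists l : 'I_r -> J, row_free (\matrix_(i < r) v (l i)).
  have [l lf] := free n (leqnn n).
  by exists l; move: lf; rewrite row_free_unit unitmxE unitfE.
elim: r => [_|r IH rn].
  have l : 'I_0 -> J by case.
  exists l.
  by rewrite -row_leq_rank.
have [l lf] := IH (ltnW rn); set M := \matrix_(i < r) _ in lf.
have : cokermx M != 0.
  by rewrite -mxrank_eq0 mxrank_coker (eqP lf) subn_eq0 -ltnNge.
move=> /eqP/matrixP coM.
have [[a b] cab] : exists ab, cokermx M ab.1 ab.2 != 0.
  apply: contrapT => /forallNP nab; apply: coM => a b.
  by rewrite [RHS]mxE; apply/eqP/negPn/negP; exact: (nab (a, b)).
(* A nonzero column of the cokernel matrix, hence a vector killed by all rows of [M]. *)
pose w := col b (cokermx M).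
have w0 : w != 0 by apply: contraNneq cab => /matrixP/(_ a 0); rewrite [LHS]mxE [RHS]mxE => ->.
have Mw : M *m w = 0 by rewrite /w colE mulmxA mulmx_coker mul0mx.
have [j vj] : exists j, v j *m w != 0.
  apply: contrapT => /forallNP nj; apply: nex; exists w => // j.
  by apply/eqP/negPn/negP; exact: nj.
exists (fun i : 'I_(1 + r) => match split i with inl _ => j | inr i' => l i' end).
rewrite (_ : \matrix_(_ < _) _ = col_mx (v j) M); last first.
  apply/row_matrixP => i; rewrite rowK; case: split_ordP => i' ->.
    by rewrite rowKu; apply/rowP => c; rewrite mxE ord1.
  by rewrite rowKd rowK.
rewrite -kermx_eq0; apply/rowV0P => u /sub_kermxP.
pose u1 := @lsubmx F 1 1 r u; pose u2 := @rsubmx F 1 1 r u.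
have -> : u = row_mx u1 u2 by rewrite hsubmxK.
rewrite (mul_row_col u1 u2) => uE.
have u10 : u1 = 0.
  move/(congr1 (mulmxr w)): uE; rewrite /= mulmxDl -!mulmxA Mw mulmx0 addr0 mul0mx.
  rewrite [u1]mx11_scalar mul_scalar_mx => /eqP.
  by rewrite scaler_eq0 (negPf vj) orbF => /eqP ->; rewrite raddf0.
move: uE; rewrite u10 mul0mx add0r => /eqP; rewrite mulmx_free_eq0 // => /eqP ->.
by rewrite row_mx0.
Qed.

(** * Density of the graphs *)

Lemma open_bigcap_ord (T : topologicalType) n (F : 'I_n -> set T) :
  (forall i, open (F i)) -> open [set x | forall i, F i x].
Proof.
elim: n F => [|n IH] F oF.
  by rewrite (_ : mkset _ = setT); [exact: openT|apply/seteqP; split=> // x _ []].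
rewrite (_ : mkset _ = F ord0 `&` [set x | forall i, F (lift ord0 i) x]).
  by apply: openI => //; apply: IH.
apply/seteqP; split=> x /= Fx; first by split=> // i; apply: Fx.
by move=> i; case: (unliftP ord0 i) Fx => [j ->|->] [].
Qed.

(** The relation expresses [b j0] through the other [b j]. Since constants of both rings have the
    same image in [C], its coefficients can be moved onto the [a j], which saves one term. *)
Lemma sum_shorten (k : fieldType) (R1 R2 C : comPzRingType)
    (f : {rmorphism R1 -> C}) (g : {rmorphism R2 -> C})
    (c1 : {rmorphism k -> R1}) (c2 : {rmorphism k -> R2})
    n (a : 'I_n.+1 -> R1) (b : 'I_n.+1 -> R2) (w : 'I_n.+1 -> k) j0 :
  (forall x, f (c1 x) = g (c2 x)) -> w j0 != 0 -> \sum_j c2 (w j) * b j = 0 ->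
  \sum_j f (a j) * g (b j) =
  \sum_j f (a (lift j0 j) - c1 (w (lift j0 j) / w j0) * a j0) * g (b (lift j0 j)).
Proof.
move=> fg w0 wb.
have : \sum_j g (c2 (w j / w j0)) * g (b j) = 0.
  have e : g (c2 (w j0)^-1 * \sum_j c2 (w j) * b j) = 0 by rewrite wb mulr0 rmorph0.
  rewrite -[RHS]e mulr_sumr rmorph_sum; apply: eq_bigr => j _.
  by rewrite [c2 (_ / _)]rmorphM !rmorphM; ring.
rewrite (bigD1_ord j0) //= divff // !rmorph1 mul1r => /eqP.
rewrite addr_eq0 => /eqP b0.
rewrite (bigD1_ord j0) //= b0 mulrN mulr_sumr -sumrN -big_split /=.
by apply: eq_bigr => j _; rewrite [f (_ - _)]rmorphB [f (_ * _)]rmorphM fg; ring.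
Qed.

Section GraphRect.
Variables (k : fieldType) (Y X P : scheme k) (p : morphism P Y) (q : morphism P X).
Hypothesis prodP : is_product p q.
Variables (U : set Y) (V : set X).
Hypotheses (chU : chart (@idfun (sect Y U) : {rmorphism _ -> _}))
  (chV : chart (@idfun (sect X V) : {rmorphism _ -> _})).
Let oU := chart_open chU.
Let oV := chart_open chV.

(** The sum on [T] is the pullback of the section on [rect] by the morphism with components the
    identity and [f], so a unit at [y] is a unit at the point of the graph over [y]. *)
Lemma graph_rect (f : morphism Y X) n (a : 'I_n -> sect Y U) (b : 'I_n -> sect X V) y :
  let T := U `&` f @^-1` V in
  germ_unit (\sum_j res (@subIsetl _ U (f @^-1` V)) (a j) *
             res (@subIsetr _ U (f @^-1` V)) (pull f oV (b j))) y ->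
  exists2 z, graph p q f z & rect p q U V z /\
    germ_unit (\sum_j rect_fst p q V chU (a j) * rect_snd p q U chV (b j)) z.
Proof.
move=> T; have oT : open T by apply: openI => //; apply: open_preim.
move=> u; have Ty : T y by exact: basic_open_sub u.
have [g [pg qg _]] := prodP (id_mor Y) f.
have pgE w : p (g w) = w by case: pg => + _; apply.
have qgE w : q (g w) = f w by case: qg => + _; apply.
have gT : T `<=` g @^-1` rect p q U V by move=> w [Uw Vw]; split; rewrite /= ?pgE ?qgE.
exists (g y); first by exists g; split=> //; exists y.
have oR := open_rect p q chU chV; have oP := open_preim g oR.
split; first exact: gT.
apply/(mor_unit oR) => /=; first exact: gT.
apply/(germ_unit_res gT) => //; move: u; congr germ_unit.
rewrite !rmorph_sum /=; apply: eq_bigr => j _; rewrite !rmorphM /=; congr (_ * _).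
- pose opU := open_preim p oU.
  have gRU : g @^-1` rect p q U V `<=` g @^-1` (p @^-1` U) by move=> w [].
  rewrite -(pull_res opU oR (@subIsetl _ _ _) gRU).
  have TpU : T `<=` g @^-1` (p @^-1` U) by move=> w /gT[].
  rewrite (res_res gRU gT TpU) //; last exact: open_preim.
  by have [_ /(_ U T oU oT TpU (@subIsetl _ _ _) (a j))] := pg => /= ->.
- pose oqV := open_preim q oV.
  have gRV : g @^-1` rect p q U V `<=` g @^-1` (q @^-1` V) by move=> w [].
  rewrite -(pull_res oqV oR (@subIsetr _ _ _) gRV).
  have TqV : T `<=` g @^-1` (q @^-1` V) by move=> w /gT[].
  rewrite (res_res gRV gT TqV) //; last exact: open_preim.
  by have [_ /(_ V T oV oT TqV (@subIsetr _ _ _) (b j))] := qg => /= ->.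
Qed.

Lemma rect_cst x : rect_fst p q V chU (cst Y U x) = rect_snd p q U chV (cst X V x).
Proof.
have oR := open_rect p q chU chV.
by rewrite /= !pull_cst !res_cst //; exact: open_preim.
Qed.

End GraphRect.

Theorem theoremD (k : closedFieldType) (char0 : [pchar k] =i pred0)
  (Y X : scheme k) (varY : variety Y) (varX : variety X)
  (qpX : quasi_projective X)
  (I : Type) (phi : I -> morphism Y X)
  (y0 : Y) (closed_y0 : closed [set y0])
  (dense_y0 : dense (range (fun i => phi i y0)))
  (P : scheme k) (p : morphism P Y) (q : morphism P X) (prodP : is_product p q) :
  dense (\bigcup_i graph p q (phi i)).
Proof.
have [intY _ ftY] := varY; have [intX _ _] := varX.
move=> O [z Oz] oO; apply: contrapT => disj.
have [U [chU Uz _]] := chart_nbhd (@openT Y) (Logic.I : setT (p z)).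
have [V [chV Vz _]] := chart_nbhd (@openT X) (Logic.I : setT (q z)).
pose oU := chart_open chU; pose oV := chart_open chV.
pose Q n := exists (a : 'I_n -> sect Y U) (b : 'I_n -> sect X V),
  let r := \sum_j rect_fst p q V chU (a j) * rect_snd p q U chV (b j) in
  germ_unit r z /\ forall w, rect p q U V w -> germ_unit r w -> O w.
have [n0 Qn0] : exists n, Q n by apply: (product_basis prodP).
have exQ : exists n, `[< Q n >] by exists n0; apply/asboolP.
case: (ex_minnP exQ) => n /asboolP[a [b [rz rO]]] nmin.
have oR := open_rect p q chU chV.
have T_eq0 i : \sum_j res (@subIsetl _ U (phi i @^-1` V)) (a j) *
    res (@subIsetr _ U (phi i @^-1` V)) (pull (phi i) (chart_open chV) (b j)) = 0.
  apply: (nowhere_unit_eq0 intY); first by apply: openI => //; apply: open_preim.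
  move=> y _ /(graph_rect prodP)[w gw [Rw uw]]; apply: disj; exists w.
  by split; [exact: rO|exists i].
(* The [b j] can be evaluated only at those images of [y0] that lie in [V]. *)
pose J := {i : I | V (phi i y0)}.
pose ev (i : J) := eval ftY closed_y0 (open_preim (phi (sval i)) oV) (proj2_sig i).
pose v (i : J) := \row_j ev i (pull (phi (sval i)) oV (b j)).
have [[w w0 vw]|[l det0]] := kernel_or_minor v.
  (* The unit locus of this combination is open, so if nonempty it would contain some [phi i y0] by
     density; but there its value is [v i *m w], which is zero. *)
  have wb : \sum_j cst X V (w j 0) * b j = 0.
    set s := \sum_j _; apply: (nowhere_unit_eq0 intX) => // x Vx ux.
    have [|x1 [u [i _ iE]]] := dense_y0 _ _ (open_basic_open s oV); first by exists x.
    have Vi : V (phi i y0) by rewrite iE; exact: basic_open_sub u.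
    have : germ_unit s (phi i y0) by rewrite iE.
    rewrite -(mor_unit oV s Vi) /s.
    apply/(eval_eq0 ftY closed_y0 (open_preim (phi i) oV) Vi).
    have /(congr1 (fun M : 'M_1 => M 0 0)) := vw (exist _ i Vi).
    rewrite !mxE => <-; rewrite !rmorph_sum; apply: eq_bigr => j _.
    by rewrite !rmorphM pull_cst eval_cst [in RHS]mxE mulrC.
  have [j0 wj0] : exists j, w j 0 != 0.
    apply: contrapT => /forallNP wj; move/eqP: w0; apply; apply/matrixP => j j'.
    by rewrite ord1 [RHS]mxE; apply/eqP/negPn/negP; exact: wj.
  (* The index [j0] rules out [n = 0]; otherwise the relation just found saves a term, against the
     minimality of [n]. *)
  case: n a b rz rO nmin T_eq0 v w w0 vw wb j0 wj0 => [|n] a b rz rO nmin _ v w _ _ wb j0 wj0.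
    by case: (j0).
  suff /nmin : `[< Q n >] by rewrite ltnn.
  apply/asboolP.
  have shorter := sum_shorten a (rect_cst p q chU chV) wj0 wb.
  exists (fun j => a (lift j0 j) - cst Y U (w (lift j0 j) 0 / w j0 0) * a j0).
  by exists (fun j => b (lift j0 j)); move: rz rO; rewrite shorter.
(* A neighbourhood of [y0] on which the pullbacks by all the selected morphisms are defined, so that
   they form one square matrix. *)
pose N := [set y | forall j : 'I_n, (phi (sval (l j)) @^-1` V) y].
have oN : open N by apply: open_bigcap_ord => j; apply: open_preim.
have Ny0 : N y0 by move=> j; apply: svalP (l j).
have NV i : N `<=` phi (sval (l i)) @^-1` V by move=> y; apply.
pose M : 'M[sect Y N]_n := \matrix_(i, j) res (NV i) (pull (phi (sval (l i))) oV (b j)).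
(* Evaluation at [y0] is a ring morphism and sends [\det M] to the nonzero determinant of values. *)
have detM : germ_unit (\det M) y0.
  apply: contrapT => /(eval_eq0 ftY closed_y0 oN Ny0)/eqP; apply/negP.
  move: det0; rewrite -det_map_mx; congr (\det _ != 0); apply/matrixP => i j.
  by rewrite !mxE /ev -(eval_res ftY closed_y0 _ _ oN Ny0 (NV i)).
pose N' := N `&` U; have oN' : open N' by apply: openI.
have N'N : N' `<=` N by move=> y [].
have N'U : N' `<=` U by move=> y [].
have N'0 : N' !=set0 by apply: (integral_irreducible intY) => //; [exists y0|exists (p z)].
(* The point [y0] may lie outside [U], hence outside [N']; but the unit locus of [\det M] is a
   nonempty open set, so it meets [N']. *)
have detM0 : res N'N (\det M) <> 0.
  have [|y [ydet N'y]] := integral_irreducible intY (open_basic_open (\det M) oN) oN' _ N'0.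
    by exists y0.
  move=> d0; apply: (germ_unit0 (x := y) oN'); rewrite -d0.
  exact/germ_unit_res.
have Ma : map_mx (res N'N) M *m \col_j res N'U (a j) = 0.
  apply/matrixP => i c; rewrite !mxE.
  have N'T : N' `<=` U `&` phi (sval (l i)) @^-1` V by move=> y [Ny Uy]; split=> //; apply: Ny.
  have oT : open (U `&` phi (sval (l i)) @^-1` V) by apply: openI => //; apply: open_preim.
  have oiV := open_preim (phi (sval (l i))) oV.
  have := congr1 (res N'T) (T_eq0 (sval (l i))); rewrite rmorph0 rmorph_sum => e.
  rewrite -[RHS]e; apply: eq_bigr => j _; rewrite !mxE rmorphM mulrC.
  have N'V : N' `<=` phi (sval (l i)) @^-1` V by move=> y /N'N/NV.
  by rewrite (res_res (NV i) N'N N'V) // (res_res _ N'T N'U) // (res_res _ N'T N'V).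
(* The adjugate turns the system into [\det M * a j = 0] on [N'], where sections form a domain;
   vanishing on [N'] implies vanishing on [U]. *)
have a0 j : a j = 0.
  apply: (res_inj intY (VU := N'U)) => //.
  have := congr1 (mulmx (\adj (map_mx (res N'N) M))) Ma.
  rewrite mulmx0 mulmxA mul_adj_mx mul_scalar_mx det_map_mx => /matrixP/(_ j 0).
  rewrite !mxE => /(proj2 (proj2 intY N' oN' N'0)) [] //.
apply: (germ_unit0 (x := z) oR); move: rz; congr germ_unit.
by rewrite big1 // => j _; rewrite a0 rmorph0 mul0r.
Qed.
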